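(* Let $H$ be an infinite-dimensional separable complex Hilbert space, let $A\in L(H)$, let $\Omega\subset\mathbb C$ be open, let $r \in \mathbb N\cup\{0, \infty\}$, and let $d:\Omega\to\operatorname{Int} W_e(A)$ be a $C^r$-function. Then there exists a sequence $(u_n)_{n=1}^\infty \subset C^r (\Omega, H)$ such that (i) $\|u_n(\omega)\|=1$ for all $n\in\mathbb N$ and $\omega\in \Omega$; (ii) if $n\ne m$, then $u_m(\omega)\perp u_n(\omega')$ for all $\omega,\omega'\in \Omega$; (iii) $\langle Au_n(\omega),u_n(\omega)\rangle=d(\omega)$ for all $n\in\mathbb N$ and $\omega\in \Omega$; (iv) there exist a Hilbert space $X$ and a function $S \in C^r(\Omega, L(X, H))$ such that $S(\omega)$ is an isometry for every $\omega\in\Omega$ and \[ S^*(\omega) A S(\omega)=d(\omega) I, \qquad \omega \in \Omega. \]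
   Context: For $T\in L(H)$ the essential numerical range $W_e(T)$ is the set of all $\lambda\in\mathbb C$ for which there is an orthonormal sequence $(u_n)$ in $H$ with $\langle Tu_n,u_n\rangle\to\lambda$; $\operatorname{Int}$ denotes the interior in $\mathbb C$. Differentiability is understood in the real sense: $\Omega\subset\mathbb C$ is regarded as an open subset of $\mathbb R^2$, and $C^r(\Omega,X)$ (for a Banach space $X$, or $X=\mathbb C$) is the space of $r$ times continuously (real-)differentiable functions $\Omega\to X$, with $C^0$ meaning continuous and $C^\infty$ meaning infinitely differentiable. *)

(* Defs.v *)
From mathcomp Require Import all_boot all_order all_algebra.
From mathcomp Require Import complex.
From mathcomp Require Import all_classical all_reals Rstruct.
From Stdlib Require Import ClassicalEpsilon.

Set Implicit Arguments.
Unset Strict Implicit.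
Unset Printing Implicit Defensive.

Import Order.TTheory GRing.Theory Num.Theory.
Local Open Scope ring_scope.
Local Open Scope complex_scope.

Notation RR := Rdefinitions.R.
Notation C := (complex RR).

Definition cre (z : C) : RR := let: Complex a _ := z in a.
Definition cim (z : C) : RR := let: Complex _ b := z in b.
Definition cabs (z : C) : RR := Num.sqrt (cre z ^+ 2 + cim z ^+ 2).
Definition cconj (z : C) : C := conjc z.
Definition creal (x : RR) : C := (x%:C)%C.
Definition cI : C := 'i%C.

Record hilbert := Hilbert {
  hcarrier :> lmodType C;
  hinner : hcarrier -> hcarrier -> C;
  hinnerDl : forall (a : C) (x y z : hcarrier),
      hinner (a *: x + y) z = a * hinner x z + hinner y z;
  hinnerC : forall x y : hcarrier, hinner y x = cconj (hinner x y);
  hinner_ge0 : forall x : hcarrier, cim (hinner x x) = 0 /\ 0 <= cre (hinner x x);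
  hinner_eq0 : forall x : hcarrier, hinner x x = 0 -> x = 0;
  hcomplete : forall u : nat -> hcarrier,
      (forall eps : RR, 0 < eps -> exists N : nat, forall m n : nat,
         (N <= m)%N -> (N <= n)%N ->
         Num.sqrt (cre (hinner (u m - u n) (u m - u n))) < eps) ->
      exists l : hcarrier, forall eps : RR, 0 < eps -> exists N : nat,
         forall n : nat, (N <= n)%N ->
         Num.sqrt (cre (hinner (u n - l) (u n - l))) < eps
}.

Definition inner {H : hilbert} (x y : H) : C := hinner x y.
Definition hnorm {H : hilbert} (x : H) : RR := Num.sqrt (cre (inner x x)).

Definition separable (H : hilbert) : Prop :=
  exists e : nat -> H, forall (x : H) (eps : RR), 0 < eps ->
    exists n : nat, hnorm (x - e n) < eps.

Definition finite_dim (H : hilbert) : Prop :=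
  exists (n : nat) (b : 'I_n -> H), forall x : H,
    exists c : 'I_n -> C, x = \sum_(i < n) c i *: b i.

Definition infinite_dim (H : hilbert) : Prop := ~ finite_dim H.

Definition bounded_linear {X H : hilbert} (T : X -> H) : Prop :=
  (forall (a : C) (x y : X), T (a *: x + y) = a *: T x + T y) /\
  exists M : RR, forall x : X, hnorm (T x) <= M * hnorm x.

Definition adjoint {X H : hilbert} (T : X -> H) : H -> X :=
  epsilon (inhabits (fun _ : H => (0 : X)))
    (fun Ts : H -> X => forall (x : X) (y : H), inner (T x) y = inner x (Ts y)).

Definition is_isometry {X H : hilbert} (T : X -> H) : Prop :=
  forall x : X, hnorm (T x) = hnorm x.

Definition orthonormal {H : hilbert} (u : nat -> H) : Prop :=
  forall m n : nat, inner (u m) (u n) = (if m == n then 1 else 0).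

Definition ccvg (z : nat -> C) (l : C) : Prop :=
  forall eps : RR, 0 < eps -> exists N : nat, forall n : nat,
    (N <= n)%N -> cabs (z n - l) < eps.

Definition ess_num_range {H : hilbert} (T : H -> H) : set C :=
  fun lam => exists u : nat -> H, orthonormal u /\
    ccvg (fun n => inner (T (u n)) (u n)) lam.

Definition cinterior (W : set C) : set C :=
  fun z => exists eps : RR, 0 < eps /\ forall w : C, cabs (w - z) < eps -> W w.

Definition copen (O : set C) : Prop :=
  forall z, O z -> exists eps : RR, 0 < eps /\ forall w : C, cabs (w - z) < eps -> O w.

(* Real differentiability classes C^r(Omega, V), Omega an open subset of
   C = R^2.  V is a complex vector space carrying a norm, given through the
   predicate  small v eps  <->  ||v|| <= eps.
   f is C^0 iff continuous on Omega; f is C^(k+1) iff it is continuous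
   and both partial derivatives (in the real directions 1 and i) exist at
   every point of Omega (limits in the norm of V) and are C^k on Omega.
   C^oo = C^k for all k.                                                *)
Section Cr.
Variables (V : lmodType C) (small : V -> RR -> Prop) (Om : set C).

Definition ccont (f : C -> V) : Prop :=
  forall z, Om z -> forall eps : RR, 0 < eps -> exists delta : RR, 0 < delta /\
    forall w, Om w -> cabs (w - z) < delta -> small (f w - f z) eps.

Definition is_partial (f : C -> V) (v : C) (g : C -> V) : Prop :=
  forall z, Om z -> forall eps : RR, 0 < eps -> exists delta : RR, 0 < delta /\
    forall t : RR, t != 0 -> `|t| < delta ->
      small ((creal t)^-1 *: (f (z + creal t * v) - f z) - g z) eps.

Fixpoint Ck (k : nat) (f : C -> V) : Prop :=
  match k with
  | 0%N => ccont f
  | k'.+1 => ccont f /\ exists g1 g2 : C -> V,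
      is_partial f 1 g1 /\ is_partial f cI g2 /\ Ck k' g1 /\ Ck k' g2
  end.
End Cr.

Inductive smoothness := Fin of nat | Inf.

Definition Cr (V : lmodType C) (small : V -> RR -> Prop) (Om : set C)
    (r : smoothness) (f : C -> V) : Prop :=
  match r with
  | Fin k => Ck small Om k f
  | Inf => forall k, Ck small Om k f
  end.

Definition small_C (z : C^o) (eps : RR) : Prop := cabs z <= eps.
Definition small_H {H : hilbert} (x : H) (eps : RR) : Prop := hnorm x <= eps.
Definition small_op {X H : hilbert} (T : X -> H) (eps : RR) : Prop :=
  forall x : X, hnorm (T x) <= eps * hnorm x.

Definition CrC (Om : set C) r (f : C -> C) : Prop := Cr small_C Om r (f : C -> C^o).
Definition CrH {H : hilbert} (Om : set C) r (f : C -> H) : Prop :=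
  Cr (@small_H H) Om r f.
Definition CrOp {X H : hilbert} (Om : set C) r (f : C -> (X -> H)) : Prop :=
  Cr (@small_op X H) Om r f.

(* Main.v *)
(** The vectors u_n(w) are built from one orthonormal sequence (e_k) with
    <A e_j, e_k> = 0 for j <> k, so that a combination of the e_k with real
    coefficients c_k has norm square sum c_k^2 and numerical value
    sum c_k^2 <A e_k, e_k>.  Along an orthonormal sequence every bounded functional
    tends to 0 (Bessel), hence a sequence realizing a point of W_e(A) can be
    projected into the kernel of finitely many functionals at vanishing cost; this
    lets the values <A e_k, e_k> approximate any prescribed points of W_e(A), with
    all the orthogonality relations exact.

    The prescribed points are the vertices of countably many small triangles whose
    interiors cover Int W_e(A).  Barycentric coordinates of d(w) in these triangles,
    glued by a locally finite smooth partition of unity, give the c_k^2; they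
    contain a factor that is flat on the boundary of the triangle, which makes the
    square roots c_k as smooth as d.  Splitting (e_k) into infinitely many families
    indexed by n, each with all triangles, gives the u_n.

    For (iv) the one-dimensional space X = C suffices, with S(w) x = x u_0(w). *)
From Stdlib Require Import Reals Lra.
From Coquelicot Require Import Rcomplements Hierarchy Continuity Derive AutoDerive.
Require Import Defs.
From mathcomp Require Import all_boot all_order all_algebra.
From mathcomp Require Import complex.
From mathcomp Require Import all_classical all_reals Rstruct.
Import Order.TTheory GRing.Theory Num.Theory.
Local Open Scope ring_scope.

(** * Differentiability classes of real functions on the plane *)

Section RealClasses.
Import Coquelicot.Hierarchy Coquelicot.Continuity Coquelicot.Derive.
Local Open Scope R_scope.

Definition partial1 (F : R * R -> R) (p : R * R) : R :=
  Derive (fun t => F (t, p.2)) p.1.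
Definition partial2 (F : R * R -> R) (p : R * R) : R :=
  Derive (fun t => F (p.1, t)) p.2.

(* The partial derivatives are given by the total operator [Derive], so that the
   class is local ([CkR_local]) without any choice of derivatives. *)
Fixpoint CkR (O : R * R -> Prop) (k : nat) (F : R * R -> R) : Prop :=
  (forall p, O p -> continuous F p) /\
  match k with
  | 0%N => True
  | k'.+1 =>
      (forall p, O p -> ex_derive (fun t => F (t, p.2)) p.1) /\
      (forall p, O p -> ex_derive (fun t => F (p.1, t)) p.2) /\
      CkR O k' (partial1 F) /\ CkR O k' (partial2 F)
  end.

Lemma CkR_cont O k F p : CkR O k F -> O p -> continuous F p.
Proof. by case: k => [|k] [Fc _]; apply: Fc. Qed.

Lemma CkR_pred O k F : CkR O k.+1 F -> CkR O k F.
Proof.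
elim: k F => [|k IH] F; first by case.
by move=> [Fc [F1 [F2 [C1 C2]]]]; do !split => //; apply: IH.
Qed.

Lemma locally_slice1 (P : R * R -> Prop) (p : R * R) :
  locally p P -> locally p.1 (fun t => P (t, p.2)).
Proof.
move=> [e He]; exists e => t Ht; apply: He; split => //=; exact: ball_center.
Qed.

Lemma locally_slice2 (P : R * R -> Prop) (p : R * R) :
  locally p P -> locally p.2 (fun t => P (p.1, t)).
Proof.
move=> [e He]; exists e => t Ht; apply: He; split => //=; exact: ball_center.
Qed.

Lemma partial1_ext_loc F G p :
  locally p (fun q => F q = G q) -> partial1 F p = partial1 G p.
Proof. by move=> E; apply: Derive_ext_loc; exact: (locally_slice1 _ _ E). Qed.

Lemma partial2_ext_loc F G p :
  locally p (fun q => F q = G q) -> partial2 F p = partial2 G p.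
Proof. by move=> E; apply: Derive_ext_loc; exact: (locally_slice2 _ _ E). Qed.

(** Derivatives depend on germs only: by [locally_locally], equality near [p] gives equality of the
    partials near [p], so the induction goes through. *)
Lemma CkR_ext_loc O k F G : (forall p, O p -> locally p (fun q => F q = G q)) ->
  CkR O k F -> CkR O k G.
Proof.
elim: k F G => [|k IH] F G FG.
  move=> [Fc _]; split=> // p Op; apply: (continuous_ext_loc _ F); last exact: Fc.
  exact: FG.
move=> [Fc [F1 [F2 [C1 C2]]]]; do !split.
- move=> p Op; apply: (continuous_ext_loc _ F); last exact: Fc.
  exact: FG.
- move=> p Op; apply: ex_derive_ext_loc (F1 p Op).
  exact: (locally_slice1 _ _ (FG p Op)).
- move=> p Op; apply: ex_derive_ext_loc (F2 p Op).
  exact: (locally_slice2 _ _ (FG p Op)).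
- apply: IH C1 => p Op; move: (locally_locally _ _ (FG p Op)).
  by apply: filter_imp => q; apply: partial1_ext_loc.
- apply: IH C2 => p Op; move: (locally_locally _ _ (FG p Op)).
  by apply: filter_imp => q; apply: partial2_ext_loc.
Qed.

Lemma CkR_ext O k F G : open O -> (forall p, O p -> F p = G p) ->
  CkR O k F -> CkR O k G.
Proof.
by move=> oO FG; apply: CkR_ext_loc => p Op; exact: (locally_open _ _ oO FG).
Qed.

Lemma CkR_sub (O O' : R * R -> Prop) k F :
  (forall p, O' p -> O p) -> CkR O k F -> CkR O' k F.
Proof.
move=> sO; elim: k F => [|k IH] F.
  by move=> [Fc _]; split=> // p /sO; apply: Fc.
move=> [Fc [F1 [F2 [C1 C2]]]]; do !split; try (by move=> p /sO; auto).
- exact: IH.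
- exact: IH.
Qed.

(** The set [O'] may vary with the point. This yields smoothness of a total weight that is a finite
    sum only locally, with a length that jumps from place to place. *)
Lemma CkR_local O k F :
  (forall p, O p -> exists O', O' p /\ CkR O' k F) -> CkR O k F.
Proof.
elim: k F => [|k IH] F H.
  by split=> // p /H[O' [O'p [Fc _]]]; apply: Fc.
do !split.
- by move=> p /H[O' [O'p [Fc _]]]; apply: Fc.
- by move=> p /H[O' [O'p [_ [F1 _]]]]; apply: F1.
- by move=> p /H[O' [O'p [_ [_ [F2 _]]]]]; apply: F2.
- by apply: IH => p /H[O' [O'p [_ [_ [_ [C1 _]]]]]]; exists O'.
- by apply: IH => p /H[O' [O'p [_ [_ [_ [_ C2]]]]]]; exists O'.
Qed.

(** Lets explicit formulas stand for the partials; they agree with [Derive] on [O] only, which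
    suffices for higher derivatives because [O] is open. *)
Lemma CkR_intro O k F F1 F2 : open O ->
  (forall p, O p -> continuous F p) ->
  (forall p, O p -> is_derive (fun t => F (t, p.2)) p.1 (F1 p)) ->
  (forall p, O p -> is_derive (fun t => F (p.1, t)) p.2 (F2 p)) ->
  CkR O k F1 -> CkR O k F2 -> CkR O k.+1 F.
Proof.
move=> oO Fc H1 H2 C1 C2; do !split=> //.
- by move=> p Op; exists (F1 p); apply: H1.
- by move=> p Op; exists (F2 p); apply: H2.
- by apply: CkR_ext C1 => // p Op; rewrite /partial1 (is_derive_unique _ _ _ (H1 p Op)).
- by apply: CkR_ext C2 => // p Op; rewrite /partial2 (is_derive_unique _ _ _ (H2 p Op)).
Qed.

Lemma is_partial1 O k F p : CkR O k.+1 F -> O p ->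
  is_derive (fun t => F (t, p.2)) p.1 (partial1 F p).
Proof. by move=> [_ [F1 _]] Op; apply: Derive_correct; apply: F1. Qed.

Lemma is_partial2 O k F p : CkR O k.+1 F -> O p ->
  is_derive (fun t => F (p.1, t)) p.2 (partial2 F p).
Proof. by move=> [_ [_ [F2 _]]] Op; apply: Derive_correct; apply: F2. Qed.

Section Closure.
Variables (O : R * R -> Prop) (oO : open O).

Lemma CkR_const k c : CkR O k (fun _ => c).
Proof.
elim: k c => [|k IH] c; first by split=> // p _; exact: continuous_const.
apply: (CkR_intro _ _ _ (fun _ => 0) (fun _ => 0)) => // p _.
- exact: continuous_const.
- exact: is_derive_const.
- exact: is_derive_const.
Qed.

Lemma CkR_plus k F G : CkR O k F -> CkR O k G -> CkR O k (fun p => F p + G p).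
Proof.
elim: k F G => [|k IH] F G CF CG.
  by split=> // p Op; apply: continuous_plus; apply: CkR_cont Op; eassumption.
apply: (CkR_intro _ _ _ (fun p => partial1 F p + partial1 G p)
                        (fun p => partial2 F p + partial2 G p)) => //.
- by move=> p Op; apply: continuous_plus; apply: CkR_cont Op; eassumption.
- by move=> p Op; apply: is_derive_plus; apply: is_partial1 Op; eassumption.
- by move=> p Op; apply: is_derive_plus; apply: is_partial2 Op; eassumption.
- by apply: IH; [case: CF => _ [_ [_ []]] | case: CG => _ [_ [_ []]]].
- by apply: IH; [case: CF => _ [_ [_ []]] | case: CG => _ [_ [_ []]]].
Qed.

Lemma CkR_mult k F G : CkR O k F -> CkR O k G -> CkR O k (fun p => F p * G p).
Proof.
have cM j A B p : CkR O j A -> CkR O j B -> O p ->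
    continuous (fun p => A p * B p) p.
  by move=> CA CB Op; apply: continuous_mult; apply: CkR_cont Op; eassumption.
elim: k F G => [|k IH] F G CF CG; first by split=> // p Op; exact: cM CF CG Op.
have F0 := CkR_pred _ _ _ CF; have G0 := CkR_pred _ _ _ CG.
apply: (CkR_intro _ _ _ (fun p => partial1 F p * G p + F p * partial1 G p)
                        (fun p => partial2 F p * G p + F p * partial2 G p)) => //.
- by move=> p Op; exact: cM CF CG Op.
- move=> [x y] Op; apply: (is_derive_mult (fun t => F (t, y)) (fun t => G (t, y)) x).
  + exact: is_partial1 CF Op.
  + exact: is_partial1 CG Op.
- move=> [x y] Op; apply: (is_derive_mult (fun t => F (x, t)) (fun t => G (x, t)) y).
  + exact: is_partial2 CF Op.
  + exact: is_partial2 CG Op.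
- case: CF CG => _ [_ [_ [CF _]]] [_ [_ [_ [CG _]]]].
  by apply: CkR_plus; apply: IH.
- case: CF CG => _ [_ [_ [_ CF]]] [_ [_ [_ [_ CG]]]].
  by apply: CkR_plus; apply: IH.
Qed.

Lemma CkR_sum k n (f : nat -> R * R -> R) : (forall i, CkR O k (f i)) ->
  CkR O k (fun p => \big[Rplus/0]_(i < n) f i p).
Proof.
move=> Hf; elim: n => [|n IH].
  by apply: (CkR_ext _ _ (fun _ => 0)) (CkR_const _ _) => // p _; rewrite big_ord0.
apply: (CkR_ext _ _ (fun p => \big[Rplus/0]_(i < n) f i p + f n p)) => //.
  by move=> p _; rewrite big_ord_recr.
exact: CkR_plus.
Qed.

Lemma CkR_prod k n (f : nat -> R * R -> R) : (forall i, CkR O k (f i)) ->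
  CkR O k (fun p => \big[Rmult/1]_(i < n) f i p).
Proof.
move=> Hf; elim: n => [|n IH].
  by apply: (CkR_ext _ _ (fun _ => 1)) (CkR_const _ _) => // p _; rewrite big_ord0.
apply: (CkR_ext _ _ (fun p => \big[Rmult/1]_(i < n) f i p * f n p)) => //.
  by move=> p _; rewrite big_ord_recr.
exact: CkR_mult.
Qed.

(* The functions [g] range over a class [S] that is closed under
   differentiation on [U], so no closed formula for higher derivatives is needed. *)
Lemma CkR_comp (S : (R -> R) -> Prop) (U : R -> Prop) k F g :
  (forall h, S h -> exists2 h', S h' & forall x, U x -> is_derive h x (h' x)) ->
  (forall p, O p -> U (F p)) -> CkR O k F -> S g -> CkR O k (fun p => g (F p)).
Proof.
move=> dS UF; elim: k g => [|k IH] g CF Sg; have [g' Sg' dg] := dS g Sg.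
  split=> // p Op; apply: continuous_comp; first exact: CkR_cont CF Op.
  by apply: ex_derive_continuous; exists (g' (F p)); apply: dg; apply: UF.
have Cg' := IH g' (CkR_pred _ _ _ CF) Sg'.
apply: (CkR_intro _ _ _ (fun p => partial1 F p * g' (F p))
                        (fun p => partial2 F p * g' (F p))) => //.
- move=> p Op; apply: continuous_comp; first exact: CkR_cont CF Op.
  by apply: ex_derive_continuous; exists (g' (F p)); apply: dg; apply: UF.
- move=> [x y] Op; apply: (is_derive_comp g (fun t => F (t, y))).
    exact: dg (UF _ Op).
  exact: is_partial1 CF Op.
- move=> [x y] Op; apply: (is_derive_comp g (fun t => F (x, t))).
    exact: dg (UF _ Op).
  exact: is_partial2 CF Op.
- by case: CF => _ [_ [_ [CF _]]]; apply: CkR_mult.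
- by case: CF => _ [_ [_ [_ CF]]]; apply: CkR_mult.
Qed.

End Closure.

(** * Functions flat at the origin *)

(* For real [c] this family spans a space closed under differentiation; it contains
   a smooth square root of [t * flat 0 t ^ 2], see [flat_half_sqr]. *)
Definition flat (c t : R) : R :=
  if Rlt_dec 0 t then Rpower t c * exp (- / t) else 0.

Lemma flat_pos c t : 0 < t -> flat c t = Rpower t c * exp (- / t).
Proof. by rewrite /flat; case: Rlt_dec. Qed.

Lemma flat_npos c t : t <= 0 -> flat c t = 0.
Proof. by rewrite /flat; case: Rlt_dec => // *; lra. Qed.

Lemma flat_gt0 c t : 0 < t -> 0 < flat c t.
Proof.
by move=> t0; rewrite flat_pos //; apply: Rmult_lt_0_compat; exact: exp_pos.
Qed.

Lemma flat_ge0 c t : 0 <= flat c t.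
Proof.
case: (Rlt_dec 0 t) => t0; first by left; apply: flat_gt0.
by rewrite flat_npos; lra.
Qed.

Lemma flat_half_sqr t : flat (/2) t * flat (/2) t = t * (flat 0 t * flat 0 t).
Proof.
case: (Rlt_dec 0 t) => t0; last by rewrite !flat_npos; lra.
have E : Rpower t (/2) * Rpower t (/2) = t.
  by rewrite -Rpower_plus (_ : /2 + /2 = 1) ?Rpower_1 //; lra.
rewrite !flat_pos // Rpower_O //.
by rewrite -{5}E; ring.
Qed.

Lemma flatS c t : 0 < t -> flat c t = t * flat (c - 1) t.
Proof.
move=> t0; rewrite !flat_pos // -Rmult_assoc.
have -> : Rpower t c = Rpower t 1 * Rpower t (c - 1).
  by rewrite -Rpower_plus (_ : 1 + (c - 1) = c) //; lra.
by rewrite Rpower_1.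
Qed.

(** The exponential beats every power. With [s = / t >= 1] and [a = Rabs c + 1], the tangent
    inequality [ln s <= s / a - 1 + ln a] gives [Rabs c * ln s - s <= Rabs c * ln a]. *)
Lemma flat_bounded c : exists2 M, 0 < M & forall t, t <= 1 -> flat c t <= M.
Proof.
set a := Rabs c + 1.
have a1 : 1 <= a by rewrite /a; have := Rabs_pos c; lra.
exists (exp (Rabs c * ln a)); first exact: exp_pos.
move=> t t1; case: (Rlt_dec 0 t) => t0; last first.
  by rewrite flat_npos; [left; exact: exp_pos | lra].
rewrite flat_pos // /Rpower -exp_plus.
have s1 : 1 <= / t by rewrite -Rinv_1; apply: Rinv_le_contravar.
have lnt : ln t = - ln (/ t) by rewrite ln_Rinv //; lra.
have ls0 : 0 <= ln (/ t) by rewrite -ln_1; apply: Rcomplements.ln_le; lra.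
have lns : ln (/ t) <= / t / a - 1 + ln a.
  have sa : 0 < / t / a by apply: Rdiv_lt_0_compat; lra.
  have -> : ln (/ t) = ln (/ t / a) + ln a.
    by rewrite -ln_mult //; [congr ln; field | ]; lra.
  by have := exp_ineq1_le (ln (/ t / a)); rewrite exp_ln //; lra.
have h1 : c * ln t <= Rabs c * ln (/ t).
  rewrite lnt; have := Rle_abs (- c); rewrite Rabs_Ropp => h.
  by have := Rmult_le_compat_r _ _ _ ls0 h; lra.
have h2 := Rmult_le_compat_l _ _ _ (Rabs_pos c) lns.
have h3 : Rabs c * (/ t / a) <= / t.
  have : Rabs c * (/ t / a) = / t - / t / a by rewrite /a; field; rewrite -/a; lra.
  have : 0 < / t / a by apply: Rdiv_lt_0_compat; lra.
  lra.
have h4 := Rabs_pos c.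
have : c * ln t + - / t <= Rabs c * ln a by lra.
case=> [h|->]; last by right.
by left; apply: exp_increasing.
Qed.

(** Away from 0 this is the product rule. At 0 the difference quotient for [h > 0] is
    [h * flat (c - 2) h], which tends to 0 because the second factor is bounded. *)
Lemma is_derive_flat c t :
  is_derive (flat c) t (c * flat (c - 1) t + flat (c - 2) t).
Proof.
case: (total_order_T t 0) => [[tn|->]|tp].
- apply: (is_derive_ext_loc (fun _ => 0)).
    exists (mkposreal (- t) ltac:(lra)) => y /=.
    rewrite /ball /= /AbsRing_ball /abs /minus /plus /opp /= => /Rabs_def2 hy.
    by rewrite flat_npos //; lra.
  rewrite !flat_npos; try lra.
  by rewrite Rmult_0_r Rplus_0_r; exact: is_derive_const.
- rewrite !flat_npos; [|lra|lra].
  rewrite Rmult_0_r Rplus_0_r.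
  have [M M0 HM] := flat_bounded (c - 2).
  apply/is_derive_Reals => eps eps0.
  (* The bound 1 keeps [h] in the range of [flat_bounded]; the bound [eps / M] makes [h * M] smaller
     than [eps]. *)
  have d0 : 0 < Rmin 1 (eps / M).
    by apply: Rmin_pos; [lra | apply: Rdiv_lt_0_compat].
  exists (mkposreal _ d0) => h h0 /= hd.
  have hd1 := Rlt_le_trans _ _ _ hd (Rmin_l _ _).
  have hd2 := Rlt_le_trans _ _ _ hd (Rmin_r _ _).
  rewrite Rplus_0_l (flat_npos c 0); last by right.
  rewrite !Rminus_0_r; case: (Rlt_dec 0 h) => hp; last first.
    by rewrite flat_npos; [rewrite /Rdiv Rmult_0_l Rabs_R0 | lra].
  have hE : Rabs h = h by apply: Rabs_pos_eq; lra.
  rewrite hE in hd1 hd2.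
  rewrite flatS // flatS // (_ : c - 1 - 1 = c - 2); last by lra.
  have -> : h * (h * flat (c - 2) h) / h = h * flat (c - 2) h by field; lra.
  rewrite Rabs_pos_eq; last by apply: Rmult_le_pos; [lra | exact: flat_ge0].
  apply: (Rle_lt_trans _ (h * M)).
    by apply: Rmult_le_compat_l; [lra | apply: HM; lra].
  have := Rmult_lt_compat_r M _ _ M0 hd2.
  by rewrite (_ : eps / M * M = eps) //; field; lra.
- apply: (is_derive_ext_loc (fun s => Rpower s c * exp (- / s))).
    exists (mkposreal t tp) => y /=.
    rewrite /ball /= /AbsRing_ball /abs /minus /plus /opp /= => /Rabs_def2 hy.
    by rewrite flat_pos //; lra.
  have dP : is_derive (fun s => Rpower s c) t (c * Rpower t (c - 1)).
    by apply/is_derive_Reals; exact: derivable_pt_lim_power.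
  have dE : is_derive (fun s => exp (- / s)) t (Rpower t (-2) * exp (- / t)).
    have -> : Rpower t (-2) = / (t * t).
      by rewrite (_ : -2 = - (1 + 1)); [rewrite Rpower_Ropp Rpower_plus Rpower_1 | lra].
    by auto_derive; [lra | field; lra].
  rewrite !flat_pos // (_ : c - 2 = c + -2) // Rpower_plus.
  have -> : c * (Rpower t (c - 1) * exp (- / t)) +
            Rpower t c * Rpower t (-2) * exp (- / t) =
            c * Rpower t (c - 1) * exp (- / t) +
            Rpower t c * (Rpower t (-2) * exp (- / t)) by ring.
  exact: is_derive_mult.
Qed.

Inductive flat_span : (R -> R) -> Prop :=
| flat_span_flat c : flat_span (flat c)
| flat_span_lin c g h : flat_span g -> flat_span h ->
    flat_span (fun t => c * g t + h t).

Lemma flat_span_derive g : flat_span g ->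
  exists2 g', flat_span g' & forall t, True -> is_derive g t (g' t).
Proof.
elim=> [c|c g1 h1 _ [g1' Sg dg] _ [h1' Sh dh]].
  exists (fun t => c * flat (c - 1) t + flat (c - 2) t).
    by apply: flat_span_lin; apply: flat_span_flat.
  by move=> t _; exact: is_derive_flat.
exists (fun t => c * g1' t + h1' t); first exact: flat_span_lin.
move=> t _; apply: (is_derive_plus (fun t => c * g1 t)); last exact: dh.
by apply: is_derive_scal; exact: dg.
Qed.

Lemma CkR_flat O k F c : open O -> CkR O k F -> CkR O k (fun p => flat c (F p)).
Proof.
move=> oO CF; apply: (CkR_comp _ oO _ _ _ _ _ flat_span_derive) => //.
exact: flat_span_flat.
Qed.

Lemma CkR_power O k F c : open O -> (forall p, O p -> 0 < F p) ->
  CkR O k F -> CkR O k (fun p => Rpower (F p) c).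
Proof.
(* On the positive half-line the functions [a * t ^ b] are closed under differentiation. *)
move=> oO F0 CF; apply: (CkR_comp _ oO
  (fun g => exists a b, g = fun t => a * Rpower t b) (fun t => 0 < t)
  _ _ (fun t => Rpower t c)) => //; last first.
  by exists 1, c; apply: boolp.funext => t; rewrite Rmult_1_l.
move=> _ [a [b ->]]; exists (fun t => a * b * Rpower t (b - 1)).
  by exists (a * b), (b - 1).
move=> t t0; rewrite Rmult_assoc; apply: is_derive_scal; apply/is_derive_Reals.
exact: derivable_pt_lim_power.
Qed.
End RealClasses.

(** Compares a sum cut off at a bound that depends on the point with one whose bound is frozen near
    a given point. *)
Lemma big_ord_vanish (T : Type) (idx : T) (op : Monoid.law idx) (f : nat -> T) m n :
  (forall i, (m <= i)%N -> f i = idx) -> (forall i, (n <= i)%N -> f i = idx) ->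
  \big[op/idx]_(i < m) f i = \big[op/idx]_(i < n) f i.
Proof.
wlog le_mn : m n / (m <= n)%N => [H fm fn|fm _].
  by case/orP: (leq_total m n) => le; [|symmetry]; apply: H.
rewrite -(subnKC le_mn); elim: (n - m)%N => [|k IH]; first by rewrite addn0.
by rewrite addnS big_ord_recr /= -IH fm ?leq_addr // Monoid.mulm1.
Qed.

(** * Smooth square roots of barycentric coordinates, glued over countably many triangles *)

Section BarycentricCoordinates.
Import Coquelicot.Hierarchy Coquelicot.Continuity Coquelicot.Derive.
Local Open Scope R_scope.

Lemma big_ord_triple (f : nat -> R) n :
  \big[Rplus/0]_(q < 3 * n) f q =
  \big[Rplus/0]_(j < n) (f (3 * j)%N + f (3 * j).+1 + f (3 * j).+2).
Proof.
elim: n => [|n IH]; first by rewrite muln0 !big_ord0.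
have -> : (3 * n.+1 = (3 * n).+3)%N by rewrite mulnS addnC !addnS addn0.
by rewrite !big_ord_recr /= IH !Rplus_assoc.
Qed.

(** Twice the signed area of the triangle [z], [p], [q]. *)
Definition det (p q z : R * R) : R :=
  (p.1 - z.1) * (q.2 - z.2) - (p.2 - z.2) * (q.1 - z.1).

(* Triangle [j] has the vertices [P (3 * j)], [P (3 * j).+1], [P (3 * j).+2];
   [next] permutes the indices of a triangle cyclically. *)
Definition next (q : nat) : nat := (3 * (q %/ 3) + q.+1 %% 3)%N.

Variables (O : R * R -> Prop) (P : nat -> R * R) (d : R * R -> R * R).

(** In a nondegenerate triangle, the barycentric coordinate of [z] at the vertex [q] times twice the
    signed area of the triangle. *)
Definition vdet (q : nat) (z : R * R) : R := det (P (next q)) (P (next (next q))) z.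

(** Positive exactly in the interior of triangle [j] when that triangle is positively oriented;
    otherwise zero everywhere, since the three [vdet] add up to twice the signed area. *)
Definition bump (j : nat) (z : R * R) : R :=
  flat 0 (vdet (3 * j)%N z) * flat 0 (vdet (3 * j).+1 z) * flat 0 (vdet (3 * j).+2 z).

(* Once [bump i z > / INR j.+1] for some [i < j] the factor [i] vanishes, which
   makes the family [cutoff] locally finite. *)
Definition cutoff (j : nat) (z : R * R) : R :=
  \big[Rmult/1]_(i < j) flat 0 (/ INR j.+1 - bump i z).

(** A smooth square root of [vdet q z] times the square of [bump * cutoff], a factor common to the
    three vertices. The exponent [/2] at the coordinate of [q] itself produces the factor [vdet q z]
    after squaring. *)
Definition weight (q : nat) (z : R * R) : R :=
  flat (/2) (vdet q z) * flat 0 (vdet (next q) z) * flat 0 (vdet (next (next q)) z)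
  * cutoff (q %/ 3) z.

Lemma div3_1 j : ((3 * j).+1 %/ 3)%N = j.
Proof. by rewrite -[(3 * j).+1]addn1 mulnC divnMDl // addn0. Qed.

Lemma div3_2 j : ((3 * j).+2 %/ 3)%N = j.
Proof. by rewrite -[(3 * j).+2]addn2 mulnC divnMDl // addn0. Qed.

Lemma next0 j : next (3 * j) = (3 * j).+1.
Proof. by rewrite /next mulKn // -[(3 * j).+1]addn1 {2}mulnC modnMDl. Qed.

Lemma next1 j : next (3 * j).+1 = (3 * j).+2.
Proof. by rewrite /next div3_1 -[(3 * j).+2]addn2 {2}mulnC modnMDl. Qed.

Lemma next2 j : next (3 * j).+2 = (3 * j)%N.
Proof. by rewrite /next div3_2 -[(3 * j).+3]addn3 {2}mulnC modnMDl addn0. Qed.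

Definition nextE := (next0, next1, next2).

Lemma weight_sqr j z q :
  q = (3 * j)%N \/ q = (3 * j).+1 \/ q = (3 * j).+2 ->
  weight q z * weight q z = vdet q z * (bump j z * cutoff j z * (bump j z * cutoff j z)).
Proof.
have E a b c f : flat (/2) a * b * c * f * (flat (/2) a * b * c * f) =
    a * (flat 0 a * b * c * f * (flat 0 a * b * c * f)).
  transitivity (flat (/2) a * flat (/2) a * (b * c * f * (b * c * f))); first by ring.
  by rewrite flat_half_sqr; ring.
rewrite /weight /bump.
by case=> [->|[->|->]]; rewrite !nextE ?mulKn // ?div3_1 ?div3_2 E; ring.
Qed.

(** Up to the common factor from [weight_sqr] the squares are the numbers [vdet q z], and the sum of
    [vdet q z * (P q - z)] over a triangle is identically zero, whatever its orientation. *)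
Lemma weight_barycenter j z :
  let w q := weight q z * weight q z in
  let s := w (3 * j)%N + w (3 * j).+1 + w (3 * j).+2 in
  w (3 * j)%N * (P (3 * j)%N).1 + w (3 * j).+1 * (P (3 * j).+1).1
    + w (3 * j).+2 * (P (3 * j).+2).1 = z.1 * s /\
  w (3 * j)%N * (P (3 * j)%N).2 + w (3 * j).+1 * (P (3 * j).+1).2
    + w (3 * j).+2 * (P (3 * j).+2).2 = z.2 * s.
Proof.
rewrite /= !(weight_sqr j); try by [left | right; left | right; right].
by rewrite /vdet !nextE /det; split; ring.
Qed.

Lemma bump_ge0 j z : 0 <= bump j z.
Proof.
by rewrite /bump; do !apply: Rmult_le_pos; exact: flat_ge0.
Qed.

Lemma bump_gt0P j z : 0 < bump j z <->
  0 < vdet (3 * j)%N z /\ 0 < vdet (3 * j).+1 z /\ 0 < vdet (3 * j).+2 z.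
Proof.
rewrite /bump; split; last first.
  by move=> [a [b c]]; do !apply: Rmult_lt_0_compat; exact: flat_gt0.
move=> h; do !split; apply: Rnot_le_lt => le; move: h;
  rewrite (flat_npos 0 _ le); lra.
Qed.

Lemma weight_triple_ge0 j z :
  0 <= weight (3 * j)%N z * weight (3 * j)%N z
     + weight (3 * j).+1 z * weight (3 * j).+1 z
     + weight (3 * j).+2 z * weight (3 * j).+2 z.
Proof.
have := Rle_0_sqr (weight (3 * j)%N z); have := Rle_0_sqr (weight (3 * j).+1 z).
have := Rle_0_sqr (weight (3 * j).+2 z); rewrite /Rsqr; lra.
Qed.

Hypotheses (oO : open O).
Hypothesis cover : forall p, O p -> exists j, 0 < bump j (d p).

Lemma CkR_vdet k q : CkR O k (fun p => (d p).1) -> CkR O k (fun p => (d p).2) ->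
  CkR O k (fun p => vdet q (d p)).
Proof.
move=> C1 C2; rewrite /vdet /det.
have cB u F : CkR O k F -> CkR O k (fun p => u - F p).
  move=> CF; apply: (CkR_ext _ _ (fun p => u + -1 * F p)) => //.
    by move=> p _; ring.
  by apply: CkR_plus => //; [|apply: CkR_mult => //]; apply: CkR_const.
set p1 := P _; set p2 := P _.
apply: (CkR_ext _ _ (fun p => (p1.1 - (d p).1) * (p2.2 - (d p).2)
   + -1 * ((p1.2 - (d p).2) * (p2.1 - (d p).1)))) => //.
  by move=> p _; ring.
apply: CkR_plus => //; first by apply: CkR_mult => //; apply: cB.
apply: CkR_mult => //; first exact: CkR_const.
by apply: CkR_mult => //; apply: cB.
Qed.

Lemma CkR_bump k j : CkR O k (fun p => (d p).1) -> CkR O k (fun p => (d p).2) ->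
  CkR O k (fun p => bump j (d p)).
Proof.
by move=> C1 C2; do !apply: CkR_mult => //; apply: CkR_flat => //; apply: CkR_vdet.
Qed.

Lemma CkR_cutoff k j : CkR O k (fun p => (d p).1) -> CkR O k (fun p => (d p).2) ->
  CkR O k (fun p => cutoff j (d p)).
Proof.
move=> C1 C2.
apply: (CkR_prod _ oO k j (fun i p => flat 0 (/ INR j.+1 - bump i (d p)))) => i.
apply: CkR_flat => //.
apply: (CkR_ext _ _ (fun p => / INR j.+1 + -1 * bump i (d p))) => //.
  by move=> p _; ring.
apply: CkR_plus => //; first exact: CkR_const.
by apply: CkR_mult => //; [exact: CkR_const | exact: CkR_bump].
Qed.

Lemma CkR_weight k q : CkR O k (fun p => (d p).1) -> CkR O k (fun p => (d p).2) ->
  CkR O k (fun p => weight q (d p)).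
Proof.
move=> C1 C2; apply: CkR_mult => //; last exact: CkR_cutoff.
by do !apply: CkR_mult => //; apply: CkR_flat => //; apply: CkR_vdet.
Qed.

Hypotheses (d1c : CkR O 0 (fun p => (d p).1)) (d2c : CkR O 0 (fun p => (d p).2)).

Lemma cutoff_locally_finite p : O p -> exists K : nat,
  locally p (fun p' => forall j, (K <= j)%N -> cutoff j (d p') = 0).
Proof.
move=> Op; have [i bi] := cover p Op.
have bc : continuous (fun p => bump i (d p)) p.
  exact: (CkR_cont _ _ _ _ (CkR_bump 0 i d1c d2c) Op).
pose e := bump i (d p) / 2.
have e0 : 0 < e by rewrite /e; lra.
have [N [HN N0]] := archimed_cor1 e e0.
(* From [i.+1] on the factor with index [i] occurs in the cutoff; from [N] on its argument is
   negative near [p]. *)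
exists (maxn i.+1 N).
have : locally p (fun p' => e < bump i (d p')).
  by apply: bc; apply: open_gt; rewrite /e; lra.
apply: filter_imp => p' hp' j; rewrite geq_max => /andP[ij Nj].
rewrite /cutoff (bigD1 (Ordinal ij)) // flat_npos; first exact: Rmult_0_l.
have hN : / INR j.+1 <= / INR N.
  apply: Rinv_le_contravar; first exact: lt_0_INR.
  by apply: le_INR; apply/ssrnat.leP; apply: leqW.
change (/ INR j.+1 - bump i (d p') <= 0); lra.
Qed.

(** The weights are divided by the square root of their total [W], which is positive on [O]. The
    order [k] is quantified after [K] and [a], so a single choice serves all orders, hence also the
    infinitely smooth case. *)
Theorem smooth_barycentric_coordinates :
  exists (K : R * R -> nat) (a : nat -> R * R -> R),
  [/\ forall k q, CkR O k (fun p => (d p).1) -> CkR O k (fun p => (d p).2) ->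
        CkR O k (a q),
      forall p, O p -> locally p (fun p' => forall q, (K p <= q)%N -> a q p' = 0),
      forall p, O p -> \big[Rplus/0]_(q < K p) (a q p * a q p) = 1,
      forall p, O p -> \big[Rplus/0]_(q < K p) (a q p * a q p * (P q).1) = (d p).1 &
      forall p, O p -> \big[Rplus/0]_(q < K p) (a q p * a q p * (P q).2) = (d p).2].
Proof.
have /boolp.choice[K HK] : forall p : R * R, exists K, O p ->
    locally p (fun p' => forall j, (K <= j)%N -> cutoff j (d p') = 0).
  move=> p; case: (boolp.pselect (O p)) => [/cutoff_locally_finite[K HK]|nO].
    by exists K.
  by exists 0%N.
pose w q p := weight q (d p) * weight q (d p).
pose W p := \big[Rplus/0]_(q < 3 * K p) w q p.
have wK p : O p -> locally p (fun p' => forall q, (3 * K p <= q)%N -> weight q (d p') = 0).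
  move=> Op; apply: filter_imp (HK p Op) => p' h q hq.
  by rewrite /weight h ?Rmult_0_r // leq_divRL // mulnC.
have WE p : W p = \big[Rplus/0]_(j < K p)
    (w (3 * j)%N p + w (3 * j).+1 p + w (3 * j).+2 p).
  by rewrite /W (big_ord_triple (w^~ p)).
have W0 p : O p -> 0 < W p.
  move=> Op; have ex : exists j, `[< 0 < bump j (d p) >].
    by have [j hj] := cover p Op; exists j; apply/boolp.asboolP.
  (* For the first triangle with positive bump all earlier bumps vanish, so every factor of its
     cutoff is [flat 0 (/ INR j.+1)], which is positive. *)
  case: (ex_minnP ex) => j /boolp.asboolP bj minj.
  have cj : 0 < cutoff j (d p).
    rewrite /cutoff; elim/big_ind: _ => [|x y|i _]; first lra.
      exact: Rmult_lt_0_compat.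
    apply: flat_gt0; have -> : bump i (d p) = 0.
      case: (bump_ge0 i (d p)) => // bi.
      have := minj i; rewrite leqNgt ltn_ord /= => h.
      by have := h (introT (boolp.asboolP _) bi).
    by rewrite Rminus_0_r; apply: Rinv_0_lt_compat; apply: lt_0_INR; apply/ssrnat.leP.
  have jK : (j < K p)%N.
    rewrite ltnNge; apply/negP => le; have := locally_singleton _ _ (HK p Op) j le.
    lra.
  rewrite WE (bigD1 (Ordinal jK)) //=; apply: Rplus_lt_le_0_compat.
    rewrite /w !(weight_sqr j); try by [left | right; left | right; right].
    have /bump_gt0P[v0 [v1 v2]] := bj.
    rewrite -!Rmult_plus_distr_r; apply: Rmult_lt_0_compat; first lra.
    by have b0 := Rmult_lt_0_compat _ _ bj cj; exact: (Rmult_lt_0_compat _ _ b0 b0).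
  elim/big_ind: _ => [|x y|i _]; first lra.
    exact: Rplus_le_le_0_compat.
  exact: weight_triple_ge0.
have CW k : CkR O k (fun p => (d p).1) -> CkR O k (fun p => (d p).2) -> CkR O k W.
  move=> C1 C2; apply: CkR_local => p Op.
  pose O' p' := O p' /\
    locally p' (fun p'' => forall q, (3 * K p <= q)%N -> weight q (d p'') = 0).
  have oO' : open O'.
    by apply: open_and => // p'; apply: locally_locally.
  exists O'; split; first by split=> //; apply: wK.
  apply: (CkR_ext _ _ (fun p' => \big[Rplus/0]_(q < 3 * K p) w q p')) => //.
    move=> p' [Op' /locally_singleton h].
    have h' := locally_singleton _ _ (wK p' Op').
    apply: (big_ord_vanish _ _ Rplus (w^~ p')) => q hq.
      by rewrite /w h // Rmult_0_l.
    by rewrite /w h' // Rmult_0_l.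
  apply: CkR_sum => // q; apply: (CkR_sub O); first by move=> ? [].
  by apply: CkR_mult => //; apply: CkR_weight.
pose a q p := weight q (d p) * Rpower (W p) (- / 2).
have aa q p : O p -> a q p * a q p = w q p * / W p.
  move=> Op; have E : Rpower (W p) (- / 2) * Rpower (W p) (- / 2) = / W p.
    rewrite -Rpower_plus (_ : - / 2 + - / 2 = - 1); last lra.
    by rewrite Rpower_Ropp Rpower_1 //; apply: W0.
  by rewrite -E /a /w; ring.
have Wn0 p : O p -> W p <> 0 by move=> /W0; lra.
exists (fun p => (3 * K p)%N), a; split.
- move=> k q C1 C2; apply: CkR_mult => //; first exact: CkR_weight.
  by apply: CkR_power => //; apply: CW.
- move=> p Op; apply: filter_imp (wK p Op) => p' h q hq.
  by rewrite /a h // Rmult_0_l.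
- move=> p Op; under eq_bigr do rewrite aa //.
  by rewrite -big_distrl /= -/(W p); field; apply: Wn0.
- move=> p Op; under eq_bigr do rewrite aa // Rmult_assoc (Rmult_comm (/ _)) -Rmult_assoc.
  rewrite -big_distrl /= (big_ord_triple (fun q => w q p * (P q).1)).
  under eq_bigr => j _ do rewrite (proj1 (weight_barycenter j (d p))).
  by rewrite -big_distrr /= -WE; field; apply: Wn0.
- move=> p Op; under eq_bigr do rewrite aa // Rmult_assoc (Rmult_comm (/ _)) -Rmult_assoc.
  rewrite -big_distrl /= (big_ord_triple (fun q => w q p * (P q).2)).
  under eq_bigr => j _ do rewrite (proj2 (weight_barycenter j (d p))).
  by rewrite -big_distrr /= -WE; field; apply: Wn0.
Qed.

End BarycentricCoordinates.

From mathcomp Require Import ring lra.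

(** * The modulus and conjugation on the complex numbers *)

Section ComplexModulus.

Lemma cabsE (z : C) : creal (cabs z) = `|z|.
Proof. by case: z => a b; rewrite normc_def. Qed.

Lemma creal_inj : injective creal.
Proof. exact: complexI. Qed.

Lemma crealD x y : creal (x + y) = creal x + creal y. Proof. exact: rmorphD. Qed.
Lemma crealB x y : creal (x - y) = creal x - creal y. Proof. exact: rmorphB. Qed.
Lemma crealM x y : creal (x * y) = creal x * creal y. Proof. exact: rmorphM. Qed.

Lemma cabs_ge0 z : 0 <= cabs z. Proof. exact: sqrtr_ge0. Qed.

Lemma cabsM a b : cabs (a * b) = cabs a * cabs b.
Proof. by apply: creal_inj; rewrite crealM !cabsE normrM. Qed.

Lemma cabsD a b : cabs (a + b) <= cabs a + cabs b.
Proof.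
rewrite -lecR -[leLHS]/(creal _) -[leRHS]/(creal _).
by rewrite crealD !cabsE ler_normD.
Qed.

Lemma cabsN a : cabs (- a) = cabs a.
Proof. by apply: creal_inj; rewrite !cabsE normrN. Qed.

Lemma cabs0 : cabs 0 = 0.
Proof. by apply: creal_inj; rewrite cabsE normr0. Qed.

Lemma cabs1 : cabs 1 = 1.
Proof. by apply: creal_inj; rewrite cabsE normr1. Qed.

Lemma cabs_eq0 z : cabs z = 0 -> z = 0.
Proof. by move=> h; apply: normr0_eq0; rewrite -cabsE h. Qed.

Lemma cabs_conj z : cabs (cconj z) = cabs z.
Proof. by case: z => a b; rewrite /cabs /= sqrrN. Qed.

Lemma cabs_creal x : cabs (creal x) = `|x|.
Proof. by rewrite /cabs /= expr0n /= addr0 sqrtr_sqr. Qed.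

Lemma cabs_sqr z : creal (cabs z ^+ 2) = z * cconj z.
Proof.
case: z => a b; rewrite /cabs sqr_sqrtr ?addr_ge0 ?sqr_ge0 //=.
by rewrite /cconj; simpc; congr Complex; ring.
Qed.

Lemma cre_le_cabs z : `|cre z| <= cabs z.
Proof.
case: z => a b; rewrite /cabs /= -sqrtr_sqr ler_wsqrtr // lerDl sqr_ge0 //.
Qed.

Lemma cim_le_cabs z : `|cim z| <= cabs z.
Proof.
case: z => a b; rewrite /cabs /= -sqrtr_sqr ler_wsqrtr // lerDr sqr_ge0 //.
Qed.

Lemma cabs_le_cre_cim z : cabs z <= `|cre z| + `|cim z|.
Proof.
case: z => a b; rewrite /cabs /= -[leRHS]ger0_norm ?addr_ge0 // -sqrtr_sqr.
rewrite ler_wsqrtr // -[a ^+ 2]real_normK ?num_real // -[b ^+ 2]real_normK ?num_real //.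
have := normr_ge0 a; have := normr_ge0 b; nra.
Qed.

Lemma creD a b : cre (a + b) = cre a + cre b.
Proof. by case: a b => [? ?] [? ?]. Qed.
Lemma creN a : cre (- a) = - cre a.
Proof. by case: a. Qed.
Lemma cimD a b : cim (a + b) = cim a + cim b.
Proof. by case: a b => [? ?] [? ?]. Qed.
Lemma cimN a : cim (- a) = - cim a.
Proof. by case: a. Qed.

Lemma cconjD a b : cconj (a + b) = cconj a + cconj b. Proof. exact: rmorphD. Qed.
Lemma cconjM a b : cconj (a * b) = cconj a * cconj b. Proof. exact: rmorphM. Qed.
Lemma cconjN a : cconj (- a) = - cconj a. Proof. exact: rmorphN. Qed.
Lemma cconj_creal x : cconj (creal x) = creal x. Proof. exact: conjc_real. Qed.

End ComplexModulus.

(** * Inner product, norm and the Cauchy-Schwarz inequality *)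

Section HilbertGeometry.
Variable H : hilbert.
Implicit Types (x y z : H) (a : C).

Lemma innerDl x y z : inner (x + y) z = inner x z + inner y z.
Proof. by rewrite -[x in LHS]scale1r /inner hinnerDl mul1r. Qed.

Lemma inner0l z : inner 0 z = 0.
Proof. by apply: (addrI (inner 0 z)); rewrite -innerDl !addr0. Qed.

Lemma innerZl a x z : inner (a *: x) z = a * inner x z.
Proof. by rewrite -[a *: x]addr0 /inner hinnerDl -/(inner 0 z) inner0l addr0. Qed.

Lemma inner_conj x y : inner y x = cconj (inner x y).
Proof. exact: hinnerC. Qed.

Lemma innerNl x z : inner (- x) z = - inner x z.
Proof. by rewrite -scaleN1r innerZl mulN1r. Qed.

Lemma innerDr x y z : inner x (y + z) = inner x y + inner x z.
Proof. by rewrite inner_conj innerDl cconjD -!inner_conj. Qed.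

Lemma innerNr x y : inner x (- y) = - inner x y.
Proof. by rewrite inner_conj innerNl cconjN -inner_conj. Qed.

Lemma innerZr a x y : inner x (a *: y) = cconj a * inner x y.
Proof. by rewrite inner_conj innerZl cconjM -inner_conj. Qed.

Lemma inner0r x : inner x 0 = 0.
Proof. by rewrite inner_conj inner0l /cconj conjc0. Qed.

Lemma hnorm_ge0 x : 0 <= hnorm x. Proof. exact: sqrtr_ge0. Qed.

Lemma hnorm_sqr x : creal (hnorm x ^+ 2) = inner x x.
Proof.
have [im re] := hinner_ge0 x; rewrite /hnorm sqr_sqrtr // /inner.
by case: (hinner x x) im => a b /= ->.
Qed.

Lemma hnorm_eq0 x : hnorm x = 0 -> x = 0.
Proof.
move=> h; apply: hinner_eq0; rewrite -/(inner x x) -hnorm_sqr h.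
by rewrite expr0n.
Qed.

Lemma hnormZ a x : hnorm (a *: x) = cabs a * hnorm x.
Proof.
apply/eqP; rewrite -(eqrXn2 (n := 2)) ?mulr_ge0 ?hnorm_ge0 ?cabs_ge0 //; apply/eqP.
apply: creal_inj; rewrite hnorm_sqr innerZl innerZr mulrA -cabs_sqr -hnorm_sqr.
by rewrite -crealM exprMn.
Qed.

Lemma hnorm0 : hnorm (0 : H) = 0.
Proof. by rewrite -(scale0r (0 : H)) hnormZ cabs0 mul0r. Qed.

Lemma hnormN x : hnorm (- x) = hnorm x.
Proof. by rewrite -scaleN1r hnormZ cabsN cabs1 mul1r. Qed.

Lemma cauchy_schwarz x y : cabs (inner x y) <= hnorm x * hnorm y.
Proof.
have [y0|yn0] := eqVneq (hnorm y) 0.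
  by rewrite (hnorm_eq0 _ y0) inner0r cabs0 mulr_ge0 ?hnorm_ge0.
have yp : 0 < hnorm y by rewrite lt_def yn0 hnorm_ge0.
rewrite -(ler_pXn2r (n := 2)) ?nnegrE ?mulr_ge0 ?cabs_ge0 ?hnorm_ge0 //.
set q := hnorm y ^+ 2; set c := inner x y.
have qp : 0 < q by rewrite exprn_gt0.
(* This vector is [hnorm y ^+ 2] times the component of [x] orthogonal to [y]; the scaling avoids a
   division. *)
have : 0 <= hnorm (creal q *: x - c *: y) ^+ 2 by rewrite sqr_ge0.
have -> : hnorm (creal q *: x - c *: y) ^+ 2 = q * (q * hnorm x ^+ 2 - cabs c ^+ 2).
  apply: creal_inj; rewrite hnorm_sqr !(innerDl, innerDr, innerNl, innerNr, innerZl, innerZr).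
  rewrite (inner_conj x y) -/c -!hnorm_sqr -/q cconj_creal.
  by rewrite [RHS]crealM crealB (crealM q (_ ^+ 2)) cabs_sqr; ring.
by rewrite pmulr_rge0 // subr_ge0 exprMn mulrC.
Qed.

Lemma hnormD x y : hnorm (x + y) <= hnorm x + hnorm y.
Proof.
rewrite -(ler_pXn2r (n := 2)) ?nnegrE ?addr_ge0 ?hnorm_ge0 //.
have -> : hnorm (x + y) ^+ 2 = hnorm x ^+ 2 + hnorm y ^+ 2 + 2 * cre (inner x y).
  have E (u : H) : hnorm u ^+ 2 = cre (inner u u) by rewrite -hnorm_sqr.
  rewrite !E innerDl !innerDr !creD (inner_conj x y).
  have -> : cre (cconj (inner x y)) = cre (inner x y) by case: (inner x y).
  by ring.
have := le_trans (ler_norm _) (le_trans (cre_le_cabs _) (cauchy_schwarz x y)).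
by lra.
Qed.

Lemma inner_suml (I : finType) (f : I -> H) y :
  inner (\sum_i f i) y = \sum_i inner (f i) y.
Proof.
by elim/big_rec2: _ => [|i u v _ <-]; rewrite ?inner0l ?innerDl.
Qed.

Lemma inner_sumr (I : finType) (f : I -> H) y :
  inner y (\sum_i f i) = \sum_i inner y (f i).
Proof.
by elim/big_rec2: _ => [|i u v _ <-]; rewrite ?inner0r ?innerDr.
Qed.

Lemma hnorm_sum n (f : 'I_n -> H) : hnorm (\sum_i f i) <= \sum_i hnorm (f i).
Proof.
elim/big_rec2: _ => [|i u v _ h]; first by rewrite hnorm0.
by apply: le_trans (hnormD _ _) _; rewrite lerD2l.
Qed.

End HilbertGeometry.

(** * The complex numbers as a one-dimensional Hilbert space *)

Section ComplexHilbert.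

Let cinner (z w : C^o) : C := z * cconj w.

Lemma sqrt_cinner (z : C^o) : Num.sqrt (cre (cinner z z)) = cabs z.
Proof.
rewrite /cinner -cabs_sqr -[cre _]/(cabs z ^+ 2) sqrtr_sqr.
by rewrite ger0_norm ?cabs_ge0.
Qed.

Lemma cinner_complete (u : nat -> C^o) :
  (forall eps : RR, 0 < eps -> exists N : nat, forall m n : nat,
     (N <= m)%N -> (N <= n)%N -> Num.sqrt (cre (cinner (u m - u n) (u m - u n))) < eps) ->
  exists l : C^o, forall eps : RR, 0 < eps -> exists N : nat, forall n : nat,
    (N <= n)%N -> Num.sqrt (cre (cinner (u n - l) (u n - l))) < eps.
Proof.
move=> cau.
(* Here [f] is the real or the imaginary part; completeness is inherited from the reals. *)
have cvg (f : C -> RR) : (forall z w, f (z - w) = f z - f w) ->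
    (forall z, `|f z| <= cabs z) -> exists l, Un_cv (fun n => f (u n)) l.
  move=> fB fle; suff /Rcomplete.R_complete[l hl] : Cauchy_crit (fun n => f (u n)) by exists l.
  move=> eps eps0.
  have [N hN] := cau eps (introT RltP eps0); exists N => m n /ssrnat.leP hm /ssrnat.leP hn.
  have := hN m n hm hn; rewrite sqrt_cinner => h.
  apply/RltP; rewrite RdistE -fB; exact: le_lt_trans (fle _) h.
have [a ha] : exists a, Un_cv (fun n => cre (u n)) a.
  by apply: cvg => [[? ?] [? ?]|z] //; exact: cre_le_cabs.
have [b hb] : exists b, Un_cv (fun n => cim (u n)) b.
  by apply: cvg => [[? ?] [? ?]|z] //; exact: cim_le_cabs.
exists (Complex a b : C^o) => eps eps0.
have /RltP e0 : 0 < eps / 2 by rewrite divr_gt0.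
have [N1 h1] := ha _ e0; have [N2 h2] := hb _ e0.
exists (maxn N1 N2) => n; rewrite geq_max => /andP[n1 n2]; rewrite sqrt_cinner.
move/ssrnat.leP: n1 => /h1/RltP; rewrite RdistE => g1.
move/ssrnat.leP: n2 => /h2/RltP; rewrite RdistE => g2.
apply: le_lt_trans (cabs_le_cre_cim _) _.
rewrite creD cimD creN cimN /=; move: g1 g2.
set x := `| _ |; set y := `| _ |; lra.
Qed.

Definition complex_hilbert : hilbert.
Proof.
apply: (@Hilbert (C^o : lmodType C) cinner) cinner_complete.
- by move=> a x y z; rewrite /cinner mulrDl -mulrA.
- by move=> x y; rewrite /cinner cconjM [cconj (cconj y)]conjcK mulrC.
- by move=> x; rewrite /cinner -cabs_sqr /= sqr_ge0.
- move=> x; rewrite /cinner -cabs_sqr => -[] /eqP.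
  by rewrite sqrf_eq0 => /eqP /cabs_eq0.
Defined.

Lemma hnorm_complex (z : complex_hilbert) : hnorm z = cabs z.
Proof. exact: sqrt_cinner. Qed.

End ComplexHilbert.

(** * Bounded linear maps *)

Section BoundedLinear.
Local Set Implicit Arguments.
Variables X Y : hilbert.

(** A bound of at least 1 can be divided by and multiplied into inequalities without a sign
    discussion. *)
Lemma bl_bound (T : X -> Y) : bounded_linear T ->
  exists2 M, 1 <= M & forall x, hnorm (T x) <= M * hnorm x.
Proof.
move=> [_ [M hM]]; exists (Num.max 1 M); first by rewrite le_max lexx.
move=> x; apply: le_trans (hM x) _.
by rewrite ler_wpM2r ?hnorm_ge0 // le_max lexx orbT.
Qed.

Lemma blD (T : X -> Y) (bT : bounded_linear T) x y : T (x + y) = T x + T y.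
Proof. by case: bT => L _; rewrite -[x in LHS]scale1r L scale1r. Qed.

Lemma bl0 (T : X -> Y) : bounded_linear T -> T 0 = 0.
Proof. by move=> bT; apply: (addrI (T 0)); rewrite -(blD bT) !addr0. Qed.

Lemma blZ (T : X -> Y) (bT : bounded_linear T) a x : T (a *: x) = a *: T x.
Proof. by rewrite -[a *: x]addr0 (proj1 bT) (bl0 bT) addr0. Qed.

Lemma blB (T : X -> Y) (bT : bounded_linear T) x y : T (x - y) = T x - T y.
Proof. by rewrite -scaleN1r (blD bT) (blZ bT) scaleN1r. Qed.

Lemma bl_sum (T : X -> Y) (bT : bounded_linear T) (I : finType) (f : I -> X) :
  T (\sum_i f i) = \sum_i T (f i).
Proof.
by elim/big_rec2: _ => [|i u v _ <-]; [exact: bl0 | exact: blD].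
Qed.

Lemma bl_lin (T S : X -> Y) a : bounded_linear T -> bounded_linear S ->
  bounded_linear (fun x => T x + a *: S x).
Proof.
move=> bT bS; split=> [c x y|].
  rewrite (proj1 bT) (proj1 bS) !scalerDr !scalerA [a * c]mulrC -!addrA.
  by congr (_ + _); rewrite addrCA.
have [M M1 hM] := bl_bound bT; have [N N1 hN] := bl_bound bS.
exists (M + cabs a * N) => x; apply: le_trans (hnormD _ _ _) _.
by rewrite mulrDl lerD // hnormZ -mulrA ler_wpM2l ?cabs_ge0.
Qed.

End BoundedLinear.

Lemma bl_comp (X Y Z : hilbert) (T : X -> Y) (S : Y -> Z) :
  bounded_linear T -> bounded_linear S -> bounded_linear (fun x => S (T x)).
Proof.
move=> bT bS; split=> [a x y|]; first by rewrite (proj1 bT) (proj1 bS).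
have [M M1 hM] := bl_bound bT; have [N N1 hN] := bl_bound bS.
exists (N * M) => x; apply: le_trans (hN _) _.
by rewrite -mulrA ler_wpM2l // (le_trans ler01).
Qed.

Lemma bl_id (X : hilbert) : bounded_linear (fun x : X => x).
Proof. by split=> //; exists 1 => x; rewrite mul1r. Qed.

Lemma bl_rank1 (X Y : hilbert) (phi : X -> complex_hilbert) (z : Y) :
  bounded_linear phi -> bounded_linear (fun x => (phi x : C) *: z).
Proof.
move=> bphi; split=> [a u v|].
  by rewrite (proj1 bphi) scalerDl scalerA.
have [M _ hM] := bl_bound bphi.
exists (M * hnorm z) => x; rewrite hnormZ mulrAC ler_wpM2r ?hnorm_ge0 //.
by rewrite -hnorm_complex.
Qed.

(** * Bounded functionals along orthonormal sequences, and vectors realizing points of the essential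
    numerical range *)

Section Functionals.
Local Set Implicit Arguments.
Variable H : hilbert.
Implicit Types (x y z : H) (phi psi : H -> complex_hilbert).

Lemma bl_inner y : bounded_linear (fun x => inner x y : complex_hilbert).
Proof.
split=> [a u v|]; first by rewrite innerDl innerZl.
by exists (hnorm y) => x; rewrite hnorm_complex mulrC cauchy_schwarz.
Qed.

(** Bessel's inequality without a representing vector: for [v] the sum of
    [cconj (phi (x i)) *: x i], both [phi v] and [hnorm v ^+ 2] equal the sum [s] of squares, so
    [s <= M * hnorm v] forces [hnorm v <= M]. *)
Lemma functional_bessel phi (x : nat -> H) M n : Defs.orthonormal x -> bounded_linear phi ->
  0 <= M -> (forall y, hnorm (phi y) <= M * hnorm y) ->
  \sum_(i < n) cabs (phi (x i)) ^+ 2 <= M ^+ 2.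
Proof.
move=> ox bphi M0 hM; set s := \sum_(i < n) _.
have s0 : 0 <= s by apply: sumr_ge0 => i _; apply: sqr_ge0.
pose v := \sum_(i < n) cconj (phi (x i)) *: x i.
have sC : creal s = \sum_(i < n) (phi (x i) : C) * cconj (phi (x i)).
  rewrite /s; under [RHS]eq_bigr do rewrite -cabs_sqr.
  by elim/big_rec2: _ => [|i u w _ <-] //; rewrite crealD.
have pv : phi v = creal s.
  by rewrite (bl_sum bphi) sC; apply: eq_bigr => i _; rewrite (blZ bphi) mulrC.
have nv : hnorm v ^+ 2 = s.
  apply: creal_inj; rewrite hnorm_sqr sC {1}/v inner_suml; apply: eq_bigr => i _.
  rewrite innerZl inner_sumr (bigD1 i) //= big1 => [|j ji].
    by rewrite addr0 innerZr ox eqxx mulr1 mulrC [cconj (cconj _)]conjcK.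
  by rewrite innerZr ox eq_sym (inj_eq val_inj) (negbTE ji) mulr0.
have := hM v; rewrite pv hnorm_complex cabs_creal ger0_norm // => h.
have [v0|vn0] := eqVneq (hnorm v) 0.
  by rewrite -nv v0 expr0n sqr_ge0.
have vp : 0 < hnorm v by rewrite lt_def vn0 hnorm_ge0.
have vM : hnorm v <= M by rewrite -(ler_pM2r vp) -expr2 nv.
by rewrite -nv ler_pXn2r ?nnegrE ?hnorm_ge0.
Qed.

(** Otherwise infinitely many terms have modulus at least [eps], and the partial sums of squares
    exceed every multiple of [eps ^+ 2], against Bessel. *)
Lemma functional_orthonormal_cvg0 phi (x : nat -> H) :
  Defs.orthonormal x -> bounded_linear phi ->
  forall eps : RR, 0 < eps -> exists N, forall n, (N <= n)%N -> cabs (phi (x n)) < eps.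
Proof.
move=> ox bphi eps eps0; apply: contrapT => hneg.
have step N : exists2 n, (N <= n)%N & eps <= cabs (phi (x n)).
  apply: contrapT => h; apply: hneg; exists N => n Nn.
  by rewrite ltNge; apply/negP => le; apply: h; exists n.
have big k : exists N, eps ^+ 2 *+ k <= \sum_(i < N) cabs (phi (x i)) ^+ 2.
  elim: k => [|k [N hN]]; first by exists 0%N; rewrite big_ord0 mulr0n.
  have [n Nn en] := step N; exists n.+1; rewrite big_ord_recr /= mulrSr lerD //.
    apply: le_trans hN _; rewrite -(subnKC Nn).
    elim: (n - N)%N => [|m IH]; first by rewrite addn0.
    by rewrite addnS big_ord_recr /=; apply: le_trans IH _; rewrite lerDl sqr_ge0.
  by rewrite ler_pXn2r ?nnegrE ?cabs_ge0 // ltW.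
have [M M1 hM] := bl_bound bphi.
have M0 : 0 <= M by apply: le_trans M1.
have e2 : 0 < eps ^+ 2 by rewrite exprn_gt0.
have [N hN] := big (Num.Def.archi_bound (M ^+ 2 / eps ^+ 2)).
have := le_trans hN (@functional_bessel phi x M N ox bphi M0 hM).
rewrite leNgt -[eps ^+ 2 *+ _]mulr_natr -ltr_pdivrMl // mulrC.
by rewrite archi_boundP // divr_ge0 ?sqr_ge0.
Qed.

(* For instance the projections with finite-dimensional kernel. *)
Definition almost_id (P : H -> H) : Prop := bounded_linear P /\
  forall x : nat -> H, Defs.orthonormal x -> forall eps : RR, 0 < eps ->
    exists N, forall n, (N <= n)%N -> hnorm (P (x n) - x n) < eps.

Lemma almost_id_id : almost_id id.
Proof.
by split=> [|x _ eps e0]; [exact: bl_id | exists 0%N => n _; rewrite subrr hnorm0].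
Qed.

(** Unless [phi] already vanishes on the range of [P], subtract [phi (P x) *: w] with [w] in that
    range and [phi w = 1]. The correction tends to 0 along orthonormal sequences, and since [w] lies
    in the range of [P], functionals killed earlier stay killed. *)
Lemma almost_id_annihilate P phi : almost_id P -> bounded_linear phi ->
  exists P', [/\ almost_id P', forall x, phi (P' x) = 0 &
    forall psi, bounded_linear psi -> (forall x, psi (P x) = 0) ->
      forall x, psi (P' x) = 0].
Proof.
move=> [bP aP] bphi.
case: (pselect (forall x, phi (P x) = 0)) => [h|]; first by exists P.
move=> /existsNP[z /eqP hz].
pose w := (phi (P z) : C)^-1 *: P z.
have hw : phi w = 1 by rewrite (blZ bphi); apply: mulVf.
pose P' x := P x + (-1) *: ((phi (P x) : C) *: w).
have bP' : bounded_linear P'.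
  by apply: bl_lin => //; apply: (@bl_rank1 _ _ (fun x => phi (P x))); apply: bl_comp.
have P'E psi x : bounded_linear psi ->
    psi (P' x) = (psi (P x) : C) - (phi (P x) : C) * (psi w : C).
  by move=> bpsi; rewrite /P' (blD bpsi) !(blZ bpsi) scaleN1r.
exists P'; split; last 2 first.
- by move=> x; rewrite P'E // hw mulr1 subrr.
- by move=> psi bpsi h x; rewrite P'E // h /w (blZ bpsi) h scaler0 mulr0 subr0.
split=> // x ox eps eps0.
have e1 : 0 < eps / 2 by rewrite divr_gt0.
have [N1 h1] := aP x ox _ e1.
(* The added 1 makes the divisor visibly positive. *)
have w1 : 0 < hnorm w + 1 by rewrite ltr_wpDl ?hnorm_ge0.
have bphiP : bounded_linear (fun x => phi (P x)) by apply: bl_comp.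
have [N2 h2] := functional_orthonormal_cvg0 ox bphiP _ (divr_gt0 e1 w1).
exists (maxn N1 N2) => n; rewrite geq_max => /andP[n1 n2].
have -> : P' (x n) - x n = (P (x n) - x n) - (phi (P (x n)) : C) *: w.
  by rewrite /P' scaleN1r addrAC.
apply: le_lt_trans (hnormD _ _ _) _; rewrite hnormN hnormZ.
have := h1 n n1; have := h2 n n2; rewrite ltr_pdivlMr // => g2 g1.
have := cabs_ge0 (phi (P (x n))); have := hnorm_ge0 _ w; nra.
Qed.

(** Three functionals for each [y] are annihilated by an almost identical map [P]; then [P (x n)],
    normalized, works for large [n], as it is close to [x n]. *)
Lemma ess_num_range_vector (A : H -> H) (ys : seq H) lam (eps : RR) :
  bounded_linear A -> ess_num_range A lam -> 0 < eps ->
  exists v, [/\ hnorm v = 1,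
    forall y, y \in ys -> [/\ inner v y = 0, inner v (A y) = 0 & inner (A v) y = 0] &
    cabs (inner (A v) v - lam) < eps].
Proof.
move=> bA [x [ox cx]] eps0.
have [P [[bP aP] kP]] : exists P, almost_id P /\ forall y, y \in ys -> forall z,
    [/\ inner (P z) y = 0, inner (P z) (A y) = 0 & inner (A (P z)) y = 0].
  elim: ys => [|y ys [P [aP kP]]]; first by exists id; split=> //; apply: almost_id_id.
  have bAi (u : H) : bounded_linear (fun v => inner (A v) u : complex_hilbert).
    exact: bl_comp bA (bl_inner u).
  have [P1 [a1 k1 l1]] := almost_id_annihilate aP (bl_inner y).
  have [P2 [a2 k2 l2]] := almost_id_annihilate a1 (bl_inner (A y)).
  have [P3 [a3 k3 l3]] := almost_id_annihilate a2 (bAi y).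
  have L psi : bounded_linear psi -> (forall z, psi (P z) = 0) -> forall z, psi (P3 z) = 0.
    by move=> bpsi h; do 2!(apply: l3 || apply: l2) => //; apply: l1.
  exists P3; split=> // u; rewrite inE => /orP[/eqP->|/kP h] z.
    split; [|exact: (l3 _ (bl_inner _) k2)|exact: k3].
    exact: (l3 _ (bl_inner _) (l2 _ (bl_inner _) k1)).
  split; [apply: (L _ (bl_inner u))|apply: (L _ (bl_inner (A u)))|apply: (L _ (bAi u))];
    by move=> t; case: (h t).
(* On unit vectors the form of [B] is the error to be bounded; being homogeneous, it can be
   estimated before normalization. *)
pose B y := A y + (- lam) *: y.
have bB : bounded_linear B by apply: bl_lin => //; apply: bl_id.
have BE y : inner (B y) y = inner (A y) y - lam * creal (hnorm y ^+ 2).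
  by rewrite innerDl innerZl hnorm_sqr mulNr.
have [M M1 hM] := bl_bound bB.
(* With [dl < 1 / 2] and [M * dl < eps / 24] the form of [B] at [y] is below
   [eps / 8 + 5 / 2 * (eps / 24) < eps / 4], while [hnorm y ^+ 2 >= 1 / 4]. *)
have M24 : 0 < 24 * M by lra.
have [N1 h1] := cx _ (divr_gt0 eps0 (ltr0n _ 8)).
have [N2 h2] := aP x ox _ (divr_gt0 eps0 M24).
have [N3 h3] := aP x ox _ (divr_gt0 ltr01 (ltr0n _ 2)).
pose n := maxn N1 (maxn N2 N3).
have {}h1 := h1 n (leq_maxl _ _).
have {}h2 := h2 n (leq_trans (leq_maxl _ _) (leq_maxr _ _)).
have {}h3 := h3 n (leq_trans (leq_maxr _ _) (leq_maxr _ _)).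
set y := P (x n) in h2 h3; set dl := hnorm (y - x n) in h2 h3.
have nx : hnorm (x n) = 1.
  by rewrite /hnorm ox eqxx /= sqrtr1.
have dl0 : 0 <= dl := hnorm_ge0 _ _.
have ny : 1 <= hnorm y + dl.
  rewrite -nx; have -> : x n = y - (y - x n) by rewrite opprB addrC subrK.
  by apply: le_trans (hnormD _ _ _) _; rewrite hnormN.
have ny2 : hnorm y <= 1 + dl.
  by rewrite -nx; have {1}-> : y = x n + (y - x n) by [rewrite addrC subrK]; apply: hnormD.
have yp : 0 < hnorm y by lra.
pose v := creal (hnorm y)^-1 *: y.
have nv : hnorm v = 1.
  by rewrite hnormZ cabs_creal ger0_norm ?invr_ge0 ?hnorm_ge0 // mulVf // gt_eqF.
exists v; split=> //.
  move=> z /kP/(_ (x n))[k1 k2 k3].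
  by rewrite /v (blZ bA) !innerZl k1 k2 k3 !mulr0.
have -> : inner (A v) v - lam = inner (B v) v.
  by rewrite BE nv expr1n mulr1.
rewrite /v (blZ bB) innerZl innerZr !cabsM cabs_conj cabs_creal.
rewrite ger0_norm ?invr_ge0 ?hnorm_ge0 // mulrA -expr2 exprVn mulrC ltr_pdivrMr ?exprn_gt0 //.
have bx : cabs (inner (B (x n)) (x n)) < eps / 8.
  by rewrite BE nx expr1n mulr1.
have E : inner (B y) y = inner (B (x n)) (x n) + (inner (B (y - x n)) y
    + inner (B (x n)) (y - x n)).
  by rewrite (blB bB) innerDl innerNl innerDr innerNr; ring.
have t1 : cabs (inner (B (y - x n)) y) <= M * dl * (1 + dl).
  apply: le_trans (cauchy_schwarz _ _ _) _.
  by apply: ler_pM; rewrite ?hnorm_ge0.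
have t2 : cabs (inner (B (x n)) (y - x n)) <= M * dl.
  apply: le_trans (cauchy_schwarz _ _ _) _.
  by rewrite ler_wpM2r ?hnorm_ge0 // -[M]mulr1 -nx.
have t3 : cabs (inner (B y) y) < eps / 8 + (M * dl * (1 + dl) + M * dl).
  rewrite E; apply: le_lt_trans (cabsD _ _) _; apply: ltr_leD => //.
  by apply: le_trans (cabsD _ _) _; apply: lerD.
have t4 : 24 * (M * dl) < eps by move: h2; rewrite ltr_pdivlMr //; lra.
have M0 : 0 <= M * dl by rewrite mulr_ge0 //; lra.
have y4 : 1 / 4 <= hnorm y ^+ 2 by nra.
nra.
Qed.

(** Recursive choice of vectors. Each new one is orthogonal to [y] and [A y] for all earlier [y],
    and so is its image to [y]; this gives the vanishing of [inner (A (e j)) (e k)] for both orders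
    of the indices. *)
Lemma essentially_diagonal_sequence (A : H -> H) (t : nat -> C) (tol : nat -> RR) :
  bounded_linear A -> (forall k, ess_num_range A (t k)) -> (forall k, 0 < tol k) ->
  exists e : nat -> H, [/\ forall k, hnorm (e k) = 1,
    forall j k, j != k -> inner (e j) (e k) = 0,
    forall j k, j != k -> inner (A (e j)) (e k) = 0 &
    forall k, cabs (inner (A (e k)) (e k) - t k) < tol k].
Proof.
move=> bA ht htol.
have /choice[pick hpick] : forall q : nat * seq H, exists v, [/\ hnorm v = 1,
    forall y, y \in q.2 -> [/\ inner v y = 0, inner v (A y) = 0 & inner (A v) y = 0] &
    cabs (inner (A v) v - t q.1) < tol q.1].
  by move=> [k ys]; apply: ess_num_range_vector.
(* The list of the first [k] chosen vectors: every choice depends on all earlier ones, so the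
   recursion carries them along. *)
pose prefix := fix prefix k := if k is k'.+1 then pick (k', prefix k') :: prefix k' else [::].
pose e k := pick (k, prefix k).
have pe j k : (j < k)%N -> e j \in prefix k.
  elim: k => // k IH; rewrite ltnS leq_eqVlt inE => /orP[/eqP->|/IH->].
    by rewrite eqxx.
  by rewrite orbT.
have ort j k : (j < k)%N -> [/\ inner (e k) (e j) = 0, inner (e k) (A (e j)) = 0 &
    inner (A (e k)) (e j) = 0].
  by move=> /pe; case: (hpick (k, prefix k)) => _ h _ /h.
exists e; split.
- by move=> k; case: (hpick (k, prefix k)).
- move=> j k; rewrite neq_ltn => /orP[/ort[h _ _]|/ort[h _ _]] //.
  by rewrite inner_conj h /cconj conjc0.
- move=> j k; rewrite neq_ltn => /orP[/ort[_ h _]|/ort[_ _ h]] //.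
  by rewrite inner_conj h /cconj conjc0.
- by move=> k; case: (hpick (k, prefix k)).
Qed.

End Functionals.

(** * Passage between real coordinate functions and the classes [Ck] with values in [C] or [H] *)

Section Bridge.
Local Set Implicit Arguments.
Import Coquelicot.Hierarchy Coquelicot.Continuity Coquelicot.Derive.
Local Open Scope ring_scope.

Definition coords (z : C) : R * R := (cre z, cim z).
Definition of_coords (p : R * R) : C := Complex p.1 p.2.

Lemma of_coordsK p : coords (of_coords p) = p. Proof. by case: p. Qed.
Lemma coordsK z : of_coords (coords z) = z. Proof. by case: z. Qed.

Lemma ball_RR (x y : R) (e : posreal) :
  Hierarchy.ball x e y <-> `|y - x| < e :> RR.
Proof.
rewrite -RabsE; split; first by move=> h; apply/RltP.
by move=> /RltP.
Qed.

Lemma locally_coords (p : R * R) (Q : R * R -> Prop) : locally p Q ->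
  exists2 dl : RR, 0 < dl & forall w : C, cabs (w - of_coords p) < dl -> Q (coords w).
Proof.
move=> [e he]; exists e; first by apply/RltP; case: e {he}.
move=> w hw; apply: he; split; apply/ball_RR.
  apply: le_lt_trans hw; apply: le_trans (cre_le_cabs _).
  by rewrite creD creN.
apply: le_lt_trans hw; apply: le_trans (cim_le_cabs _).
by rewrite cimD cimN.
Qed.

Lemma coords_locally (p : R * R) (Q : R * R -> Prop) (dl : RR) : 0 < dl ->
  (forall w : C, cabs (w - of_coords p) < dl -> Q (coords w)) -> locally p Q.
Proof.
(* Balls of the product are squares; the one with half-side [dl / 2] lies in the disc of radius
   [dl]. *)
move=> dl0 h; have /RltP e0 : 0 < dl / 2 by rewrite divr_gt0.
exists (mkposreal _ e0) => q [/ball_RR h1 /ball_RR h2].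
rewrite -(of_coordsK q); apply: h; apply: le_lt_trans (cabs_le_cre_cim _) _.
rewrite creD creN cimD cimN /=; move: h1 h2 => /=; set x := `| _ |; set y := `| _ |; lra.
Qed.

Variables (Om : set C) (oOm : copen Om).

Definition plane_of (p : R * R) : Prop := Om (of_coords p).

Lemma plane_of_coords z : Om z -> plane_of (coords z).
Proof. by rewrite /plane_of coordsK. Qed.

Lemma open_plane_of : open plane_of.
Proof.
move=> p Op; have [e [e0 he]] := oOm Op.
by apply: (@coords_locally p plane_of e e0) => w hw; apply: plane_of_coords; apply: he.
Qed.

Lemma filter_forall_lt (T : Type) (F : (T -> Prop) -> Prop) {FF : Filter F}
  (Q : nat -> T -> Prop) n : (forall q, (q < n)%N -> F (Q q)) ->
  F (fun x => forall q, (q < n)%N -> Q q x).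
Proof.
elim: n => [|n IH] h; first by apply: filter_imp filter_true.
have h1 := IH (fun q qn => h q (leqW qn)); have h2 := h n (ltnSn n).
apply: filter_imp (filter_and _ _ h1 h2) => x [g1 g2] q.
by rewrite ltnS leq_eqVlt => /orP[/eqP->|/g1].
Qed.

Lemma is_derive_diff_quotient (f : R -> R) (x l eps : RR) : is_derive f x l -> 0 < eps ->
  locally (0 : R) (fun t : R => t <> 0 -> `|(f (x + t) - f x) / t - l| < eps).
Proof.
move=> /is_derive_Reals df /RltP e0; have [dl h] := df _ e0.
exists dl => t /ball_RR; rewrite subr0 -RabsE => /RltP ht t0.
by have /RltP := h t t0 ht; rewrite -RabsE RdivE.
Qed.

Lemma diff_quotient_is_derive (f : R -> R) (x l : RR) :
  (forall eps : RR, 0 < eps -> exists2 dl : RR, 0 < dl &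
    forall t : RR, t != 0 -> `|t| < dl -> `|(f (x + t) - f x) / t - l| < eps) ->
  is_derive f x l.
Proof.
move=> h; apply/is_derive_Reals => eps e0.
have [dl /RltP d0 hd] := h eps (introT RltP e0).
exists (mkposreal _ d0) => t /eqP t0 /RltP; rewrite RabsE => ht.
by apply/RltP; rewrite RabsE; apply: hd.
Qed.

(** Stated for a real-linear contraction [L] so that real and imaginary parts are treated
    together. *)
Lemma CkR_of_Ck (L : C -> RR) : (forall z w, L (z - w) = L z - L w) ->
  (forall t z, L (creal t * z) = t * L z) -> (forall z, `|L z| <= cabs z) ->
  forall k (f : C -> C), Ck small_C Om k (f : C -> C^o) ->
  CkR plane_of k (fun p => L (f (of_coords p))).
Proof.
move=> LB LZ Lle.
have cont f p : ccont small_C Om (f : C -> C^o) -> plane_of p ->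
    continuous (fun p => L (f (of_coords p))) p.
  move=> cf Op; apply/filterlim_locally => eps.
  (* Halving turns the non-strict bound of [small_C] into a strict one. *)
  have e2 : 0 < (eps : RR) / 2 by rewrite divr_gt0 //; apply/RltP; case: eps.
  have [dl [d0 hd]] := cf _ Op _ e2; have [e [e0 he]] := oOm Op.
  have m0 : 0 < Num.min dl e by rewrite lt_min d0.
  apply: (@coords_locally _ _ _ m0) => w; rewrite lt_min => /andP[wd we].
  have := hd w (he w we) wd; rewrite /small_C => g.
  apply/ball_RR; rewrite coordsK -LB; apply: le_lt_trans (Lle _) _.
  by apply: le_lt_trans g _; move: e2; set x := (eps : RR); lra.
have quot f g v z : is_partial small_C Om (f : C -> C^o) v (g : C -> C^o) -> Om z ->
    forall eps : RR, 0 < eps -> exists2 dl : RR, 0 < dl &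
    forall t : RR, t != 0 -> `|t| < dl ->
      `|(L (f (z + creal t * v)) - L (f z)) / t - L (g z)| < eps.
  move=> pf Oz eps e0; have e2 : 0 < eps / 2 by rewrite divr_gt0.
  have [dl [d0 hd]] := pf z Oz _ e2; exists dl => // t t0 ht.
  have := hd t t0 ht; rewrite /small_C => h.
  have -> : (L (f (z + creal t * v)) - L (f z)) / t - L (g z) =
      L ((creal t)^-1 * (f (z + creal t * v) - f z) - g z).
    have -> : (creal t)^-1 = creal t^-1 by rewrite /creal fmorphV.
    by rewrite LB LZ LB mulrC.
  apply: le_lt_trans (Lle _) _; apply: le_lt_trans h _; lra.
elim=> [|k IH] f; first by move=> cf; split=> // p; apply: cont.
move=> [cf [g1 [g2 [p1 [p2 [c1 c2]]]]]].
apply: (CkR_intro _ _ _ _ _ open_plane_of _ _ _ (IH _ c1) (IH _ c2)).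
- by move=> p; apply: cont.
- move=> p Op; apply: diff_quotient_is_derive => eps e0.
  have [dl d0 hd] := quot _ _ _ _ p1 Op eps e0; exists dl => // t t0 ht.
  have := hd t t0 ht; congr (`|(L (f _) - _) / _ - _| < _).
  by rewrite mulr1 /of_coords /creal; simpc.
- move=> p Op; apply: diff_quotient_is_derive => eps e0.
  have [dl d0 hd] := quot _ _ _ _ p2 Op eps e0; exists dl => // t t0 ht.
  have := hd t t0 ht; congr (`|(L (f _) - _) / _ - _| < _).
  by rewrite /of_coords /creal /cI; simpc.
Qed.

Variables (H : hilbert) (e : nat -> H) (K : R * R -> nat).
Hypothesis e1 : forall q, hnorm (e q) = 1.

(** The length of the sum varies with [z]; for locally finite [a] it can be frozen near each point,
    see [combination_near]. *)
Definition combination (a : nat -> R * R -> R) (z : C) : H :=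
  \sum_(q < K (coords z)) creal (a q (coords z)) *: e q.

Definition locally_finite (a : nat -> R * R -> R) : Prop :=
  forall p, plane_of p -> locally p (fun p' => forall q, (K p <= q)%N -> a q p' = 0).

Lemma hnorm_combination n (b : nat -> RR) (eps : RR) :
  (forall q, (q < n)%N -> `|b q| < eps / n.+1%:R) -> 0 < eps ->
  hnorm (\sum_(q < n) creal (b q) *: e q) <= eps.
Proof.
move=> hb e0; apply: le_trans (hnorm_sum _ _ _) _.
(* The denominator [n.+1] is nonzero for the empty sum too. *)
apply: (@le_trans _ _ (\sum_(q < n) eps / n.+1%:R)).
  by apply: ler_sum => q _; rewrite hnormZ e1 mulr1 cabs_creal ltW // hb.
rewrite sumr_const card_ord -[_ *+ n]mulr_natr mulrAC ler_pdivrMr ?ltr0n //.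
by rewrite ler_pM2l // ler_nat.
Qed.

Lemma combination_near a p : locally_finite a -> plane_of p ->
  locally p (fun p' => combination a (of_coords p') =
    \sum_(q < K p) creal (a q p') *: e q).
Proof.
move=> lf Op.
have nO : locally p plane_of by apply: open_plane_of.
apply: filter_imp (filter_and _ _ (lf p Op) nO) => p' [h Op']; rewrite /combination of_coordsK.
have h' := locally_singleton _ _ (lf _ Op').
apply: (big_ord_vanish _ _ +%R (fun q => creal (a q p') *: e q)) => q hq.
  by rewrite h' // scale0r.
by rewrite h // scale0r.
Qed.

Lemma combination_ccont a k : locally_finite a -> (forall q, CkR plane_of k (a q)) ->
  ccont (@small_H H) Om (combination a).
Proof.
move=> lf Ca z Oz eps eps0; have Op := plane_of_coords Oz; set p := coords z in Op.
have en : 0 < eps / (K p).+1%:R by rewrite divr_gt0 // ltr0n.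
have near q : (q < K p)%N -> locally p (fun p' => `|a q p' - a q p| < eps / (K p).+1%:R).
  move=> _; have /filterlim_locally c := CkR_cont _ _ _ _ (Ca q) Op.
  by have := c (mkposreal _ (elimT RltP en)); apply: filter_imp => p' /ball_RR.
have [dl d0 hd] := locally_coords
  (filter_and _ _ (filter_forall_lt (F := locally p) _ _ near) (combination_near lf Op)).
exists dl; split=> // w _ hw.
have := hd w; rewrite coordsK coordsK => /(_ hw)[h1 ->].
have -> : combination a z = \sum_(q < K p) creal (a q p) *: e q by [].
rewrite /small_H -sumrB; under eq_bigr do rewrite -scalerBl -crealB.
exact: (@hnorm_combination _ (fun q => a q (coords w) - a q p)).
Qed.

(** [shift] is the translation in direction [v], read in coordinates, so one argument covers both
    partials. Near the point the length of the sum is frozen and finitely many scalar quotients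
    remain. *)
Lemma combination_partial a a' v (shift : R -> R * R -> R * R) :
  (forall z t, coords (z + creal t * v) = shift t (coords z)) ->
  (forall p (Q : R * R -> Prop), locally p Q -> locally (0 : R) (fun t => Q (shift t p))) ->
  (forall p q (eps : RR), plane_of p -> 0 < eps ->
    locally (0 : R) (fun t : R => t <> 0 ->
      `|(a q (shift t p) - a q p) / t - a' q p| < eps)) ->
  locally_finite a -> is_partial (@small_H H) Om (combination a) v (combination a').
Proof.
move=> sh lsh da lf z Oz eps eps0; have Op := plane_of_coords Oz; set p := coords z in Op.
have en : 0 < eps / (K p).+1%:R by rewrite divr_gt0 // ltr0n.
have near : locally (0 : R) (fun t : R => forall q, (q < K p)%N -> t <> 0 ->
    `|(a q (shift t p) - a q p) / t - a' q p| < eps / (K p).+1%:R).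
  by apply: filter_forall_lt => q _; exact: da.
have [dl hd] := filter_and _ _ near (lsh _ _ (combination_near lf Op)).
exists dl; split; first by apply/RltP; case: dl {hd}.
move=> t /eqP t0 ht; have [|h1 h2] := hd t.
  by apply/ball_RR; rewrite subr0.
have -> : combination a (z + creal t * v) =
    \sum_(q < K p) creal (a q (shift t p)) *: e q.
  by rewrite -h2 -sh coordsK.
have -> : combination a z = \sum_(q < K p) creal (a q p) *: e q by [].
have -> : combination a' z = \sum_(q < K p) creal (a' q p) *: e q by [].
have -> : (creal t)^-1 = creal t^-1 by rewrite /creal fmorphV.
rewrite /small_H -sumrB scaler_sumr -sumrB.
under eq_bigr => q _ do rewrite -scalerBl scalerA -scalerBl -(crealB (a q _)) -crealM -crealB.
apply: (@hnorm_combination _ (fun q => t^-1 * (a q (shift t p) - a q p) - a' q p)) => //.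
by move=> q qK; rewrite mulrC; apply: h1.
Qed.

Lemma Ck_combination a k : locally_finite a -> (forall q, CkR plane_of k (a q)) ->
  Ck (@small_H H) Om k (combination a).
Proof.
elim: k a => [|k IH] a lf Ca; first exact: combination_ccont Ca.
split; first exact: combination_ccont Ca.
exists (combination (fun q => partial1 (a q))), (combination (fun q => partial2 (a q))).
split; [|split; [|split]].
- apply: (@combination_partial _ _ _ (fun (t : R) (p : R * R) => (p.1 + t, p.2))) => //.
  + by move=> [x y] t; rewrite mulr1 /coords /creal; simpc.
  + move=> p Q [dl h]; exists dl => t /ball_RR; rewrite subr0 => ht.
    by apply: h; split=> /=; [apply/ball_RR; rewrite addrC addKr | exact: ball_center].
  + move=> [x y] q eps Op eps0.
    exact: is_derive_diff_quotient (is_partial1 _ _ _ _ (Ca q) Op) eps0.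
- apply: (@combination_partial _ _ _ (fun (t : R) (p : R * R) => (p.1, p.2 + t))) => //.
  + by move=> [x y] t; rewrite /coords /creal /cI; simpc.
  + move=> p Q [dl h]; exists dl => t /ball_RR; rewrite subr0 => ht.
    by apply: h; split=> /=; [exact: ball_center | apply/ball_RR; rewrite addrC addKr].
  + move=> [x y] q eps Op eps0.
    exact: is_derive_diff_quotient (is_partial2 _ _ _ _ (Ca q) Op) eps0.
- apply: IH => [p Op|q]; last by case: (Ca q) => _ [_ [_ []]].
  (* A coefficient vanishing near a point has partials vanishing there, so the same [K] bounds the
     sums of derivatives. *)
  have := locally_locally _ _ (lf p Op); apply: filter_imp => p' h q hq.
  rewrite (partial1_ext_loc _ (fun _ => 0)) ?[partial1 _ _]Derive_const //.
  by apply: filter_imp h => p'' ->.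
- apply: IH => [p Op|q]; last by case: (Ca q) => _ [_ [_ []]].
  have := locally_locally _ _ (lf p Op); apply: filter_imp => p' h q hq.
  rewrite (partial2_ext_loc _ (fun _ => 0)) ?[partial2 _ _]Derive_const //.
  by apply: filter_imp h => p'' ->.
Qed.

End Bridge.

(** * A countable family of triangles that survives perturbation of the vertices *)

Section Grid.

Definition mesh (m : nat) : RR := m.+1%:R^-1.

(* The triangle contains the grid cell with lower left corner [mesh m * (a, b)]
   in its interior, even after its vertices are moved by less than [mesh m]. *)
Definition corner (s : nat * int * int) (i : nat) : C :=
  let: (m, a, b) := s in
  let h := mesh m in let x := h * a%:~R in let y := h * b%:~R in
  match i with
  | 0 => Complex (x - 4 * h) (y - 4 * h)
  | 1 => Complex (x + 9 * h) (y - 4 * h)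
  | _ => Complex (x - 4 * h) (y + 9 * h)
  end.

(** Three consecutive indices share a triangle. Numbers that code no triple repeat a default one,
    which is harmless because only covering matters. *)
Definition grid_triangle (q : nat) : nat * int * int :=
  odflt (0%N, 0, 0) (unpickle (q %/ 3)).

Definition grid_vertex (q : nat) : C := corner (grid_triangle q) (q %% 3).
Definition grid_mesh (q : nat) : RR := mesh (grid_triangle q).1.1.

Lemma mesh_gt0 m : 0 < mesh m. Proof. by rewrite invr_gt0 ltr0n. Qed.

(** With [z] as origin in the cell, the offsets -4 and 9 of the corners, lowered by at most [h] for
    the position of [z] and moved by at most [h] for the perturbation, fall into these ranges. The
    first determinant is at least [(49 - 36) * h * h], the others at least [(9 + 21) * h * h]. *)
Lemma triangle_dets_gt0 (h x0 y0 x1 y1 x2 y2 : RR) :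
  - 6 * h <= x0 <= - 3 * h -> - 6 * h <= y0 <= - 3 * h ->
  7 * h <= x1 <= 10 * h -> - 6 * h <= y1 <= - 3 * h ->
  - 6 * h <= x2 <= - 3 * h -> 7 * h <= y2 <= 10 * h -> 0 < h ->
  [/\ 0 < x1 * y2 - y1 * x2, 0 < x2 * y0 - y2 * x0 & 0 < x0 * y1 - y0 * x1].
Proof.
have prod (u v a b : RR) : 0 <= a -> 0 <= b -> a <= u -> b <= v -> a * b <= u * v.
  by move=> *; apply: ler_pM.
move=> /andP[x0l x0u] /andP[y0l y0u] /andP[x1l x1u] /andP[y1l y1u]
  /andP[x2l x2u] /andP[y2l y2u] h0.
have h2 : 0 < h * h by rewrite mulr_gt0.
split.
- have := prod x1 y2 (7 * h) (7 * h).
  have := prod (6 * h) (6 * h) (- y1) (- x2); lra.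
- have := prod (- x2) (- y0) (3 * h) (3 * h).
  have := prod y2 (- x0) (7 * h) (3 * h); lra.
- have := prod (- x0) (- y1) (3 * h) (3 * h).
  have := prod (- y0) x1 (3 * h) (7 * h); lra.
Qed.

Lemma grid_cover (W : set C) (lam : nat -> C) z :
  (forall q, W (grid_vertex q) -> cabs (lam q - grid_vertex q) < grid_mesh q) ->
  cinterior W z -> exists j, Rlt 0 (bump (fun q => coords (lam q)) j (coords z)).
Proof.
move=> hlam [eps [eps0 hW]].
(* Each vertex is within [10 * h] of [z] in both coordinates, so [22 * h < eps] puts all three into
   [W], where [lam] is controlled. *)
pose m := Num.Def.archi_bound (22 / eps); pose h := mesh m.
have h0 : 0 < h := mesh_gt0 m.
have heps : 22 * h < eps.
  rewrite /h /mesh ltr_pdivrMr ?ltr0n // mulrC -ltr_pdivrMr //.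
  apply: lt_trans (archi_boundP _) _; first by rewrite divr_ge0 // ltW.
  by rewrite ltr_nat.
pose a := Num.floor (cre z / h); pose b := Num.floor (cim z / h).
have /andP[a1 a2] : h * a%:~R <= cre z < h * a%:~R + h.
  have := floor_itv (cre z / h); rewrite -/a intrD ler_pdivlMr // ltr_pdivrMr //.
  by rewrite mulrDl mul1r mulrC.
have /andP[b1 b2] : h * b%:~R <= cim z < h * b%:~R + h.
  have := floor_itv (cim z / h); rewrite -/b intrD ler_pdivlMr // ltr_pdivrMr //.
  by rewrite mulrDl mul1r mulrC.
pose j := pickle (m, a, b).
have tri q : (q %/ 3)%N = j -> grid_triangle q = (m, a, b).
  by rewrite /grid_triangle => ->; rewrite pickleK.
have near q (i : nat) u v : (q %/ 3)%N = j -> (q %% 3)%N = i ->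
    corner (m, a, b) i = Complex u v ->
    `|u - cre z| <= 10 * h -> `|v - cim z| <= 10 * h ->
    `|cre (lam q) - u| < h /\ `|cim (lam q) - v| < h.
  move=> qj qi cE u1 v1.
  have gE : grid_vertex q = Complex u v by rewrite /grid_vertex tri // qi.
  have Wq : W (grid_vertex q).
    apply: hW; rewrite gE; apply: le_lt_trans (cabs_le_cre_cim _) _.
    rewrite creD creN cimD cimN /=; move: u1 v1; set s := `| _ |; set t := `| _ |; lra.
  have := hlam q Wq; rewrite gE /grid_mesh tri //= -/h => lt.
  split; [apply: le_lt_trans lt; apply: le_trans (cre_le_cabs _)
         |apply: le_lt_trans lt; apply: le_trans (cim_le_cabs _)].
    by rewrite creD creN.
  by rewrite cimD cimN.
exists j; apply/bump_gt0P; rewrite /vdet !nextE /det /=.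
have [] := near (3 * j)%N 0%N _ _ (mulKn j (isT : (0 < 3)%N)) (modnMr _ _) erefl.
- by rewrite ler_norml -/h; apply/andP; split; lra.
- by rewrite ler_norml -/h; apply/andP; split; lra.
rewrite -/h !ltr_norml => /andP[p1 p2] /andP[p3 p4].
have [] := near (3 * j).+1 1%N _ _ (div3_1 j) _ erefl.
- by rewrite -addn1 mulnC modnMDl.
- by rewrite ler_norml -/h; apply/andP; split; lra.
- by rewrite ler_norml -/h; apply/andP; split; lra.
rewrite -/h !ltr_norml => /andP[p5 p6] /andP[p7 p8].
have [] := near (3 * j).+2 2%N _ _ (div3_2 j) _ erefl.
- by rewrite -addn2 mulnC modnMDl.
- by rewrite ler_norml -/h; apply/andP; split; lra.
- by rewrite ler_norml -/h; apply/andP; split; lra.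
rewrite -/h !ltr_norml => /andP[r1 r2] /andP[r3 r4].
set l0 := lam (3 * j)%N in p1 p2 p3 p4 *; set l1 := lam (3 * j).+1 in p5 p6 p7 p8 *.
set l2 := lam (3 * j).+2 in r1 r2 r3 r4 *.
pose dx (l : C) := cre l - cre z; pose dy (l : C) := cim l - cim z.
have [] := @triangle_dets_gt0 h (dx l0) (dy l0) (dx l1) (dy l1) (dx l2) (dy l2).
1-6: by apply/andP; split; rewrite /dx /dy; lra.
  exact: h0.
by move=> /RltP d0 /RltP d1 /RltP d2.
Qed.

End Grid.

(** * Quadratic forms on combinations of a diagonalizing sequence *)

Section DiagonalForm.
Variables (H : hilbert) (B : H -> H) (e : nat -> H) (bB : bounded_linear B).

(** Applied to [A] for the numerical value and to the identity for the norm. *)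
Lemma diagonal_form n (c : nat -> RR) :
  (forall i j, i != j -> inner (B (e i)) (e j) = 0) ->
  inner (B (\sum_(i < n) creal (c i) *: e i)) (\sum_(i < n) creal (c i) *: e i) =
  \sum_(i < n) creal (c i * c i) * inner (B (e i)) (e i).
Proof.
move=> dB; rewrite (bl_sum bB) inner_suml; apply: eq_bigr => i _.
rewrite inner_sumr (bigD1 i) //= big1 => [|j ji].
  by rewrite addr0 (blZ bB) innerZl innerZr cconj_creal mulrA crealM.
by rewrite innerZr (blZ bB) innerZl dB ?mulr0 // eq_sym (inj_eq val_inj).
Qed.

End DiagonalForm.

(** * Operators from the one-dimensional space into [H] *)

Section RankOneIsometry.
Variable H : hilbert.

Definition ray (f : C -> H) (w : C) (x : complex_hilbert) : H := (x : C) *: f w.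

(** Sending a vector [g] to the operator [x *: g] is linear and norm preserving, so every estimate
    transfers with the same constants. *)
Lemma Ck_ray Om k (f : C -> H) : Ck (@small_H H) Om k f ->
  Ck (@small_op complex_hilbert H) Om k (ray f : C -> (complex_hilbert -> H)).
Proof.
have small g eps : small_H g eps ->
    small_op (fun x : complex_hilbert => (x : C) *: g) eps.
  move=> hg x; rewrite hnormZ hnorm_complex mulrC.
  by rewrite ler_wpM2r ?cabs_ge0.
have cont g : ccont (@small_H H) Om g ->
    ccont (@small_op complex_hilbert H) Om (ray g : C -> (complex_hilbert -> H)).
  move=> cg z Oz eps e0; have [dl [d0 hd]] := cg z Oz eps e0.
  exists dl; split=> // w Ow wz x.
  have -> : (ray g w - ray g z) x = (x : C) *: (g w - g z) by rewrite scalerBr.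
  exact: small (hd w Ow wz) x.
have part g g' v : is_partial (@small_H H) Om g v g' ->
    is_partial (@small_op complex_hilbert H) Om
      (ray g : C -> (complex_hilbert -> H)) v (ray g').
  move=> pg z Oz eps e0; have [dl [d0 hd]] := pg z Oz eps e0.
  exists dl; split=> // t t0 ht x.
  set c := (creal t)^-1.
  have E : (x : C) *: (c *: (g (z + creal t * v) - g z) - g' z) =
      c *: ((x : C) *: g (z + creal t * v) - (x : C) *: g z) - (x : C) *: g' z.
    by rewrite scalerBr scalerA mulrC -scalerA scalerBr.
  change (hnorm (c *: ((x : C) *: g (z + creal t * v) - (x : C) *: g z)
    - (x : C) *: g' z) <= eps * hnorm x).
  rewrite -E.
  exact: small (hd t t0 ht) x.
elim: k f => [|k IH] f; first exact: cont.
move=> [cf [g1 [g2 [p1 [p2 [c1 c2]]]]]]; split; first exact: cont.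
exists (ray g1), (ray g2); split; first exact: part.
by split; [exact: part | split; apply: IH].
Qed.

(** Exhibiting one adjoint makes the [epsilon] choice satisfy the defining identity; testing that
    identity at 1 determines the value. *)
Lemma adjoint_ray (f : C -> H) w y : adjoint (ray f w) y = inner y (f w).
Proof.
have ex : exists Ts : H -> complex_hilbert,
    forall x y, inner (ray f w x) y = inner x (Ts y).
  exists (fun y => inner y (f w) : complex_hilbert) => x u.
  by rewrite /ray innerZl (inner_conj _ u).
have := ClassicalEpsilon.epsilon_spec (inhabits (fun _ => 0)) _ ex (1 : C) y.
rewrite -/(adjoint _) /ray scale1r => E.
by rewrite inner_conj E /inner /= mul1r [cconj (cconj _)]conjcK.
Qed.

Lemma bl_ray (f : C -> H) w : bounded_linear (ray f w).
Proof. exact: (@bl_rank1 _ _ id _ (bl_id complex_hilbert)). Qed.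

End RankOneIsometry.

Lemma Ck_vacuous (V : lmodType C) small (Om : set C) k (f : C -> V) :
  (forall w, ~ Om w) -> Ck small Om k f.
Proof.
move=> Om0; elim: k f => [|k IH] f; first by move=> z /Om0.
split; first by move=> z /Om0.
by exists f, f; split; [move=> z /Om0 | split; [move=> z /Om0 | split; exact: IH]].
Qed.

(** * Sections with prescribed numerical value, and the theorem *)

Section Construction.
Variables (H : hilbert) (A : H -> H) (Om : set C) (d : C -> C).
Hypotheses (bA : bounded_linear A) (oOm : copen Om).
Hypothesis dW : forall w, Om w -> cinterior (ess_num_range A) (d w).
Hypothesis dc : Ck small_C Om 0 (d : C -> C^o).

Lemma cre_CkR k : Ck small_C Om k (d : C -> C^o) ->
  CkR (plane_of Om) k (fun p => (coords (d (of_coords p))).1).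
Proof.
move=> Cd; apply: (@CkR_of_Ck _ oOm cre) Cd.
- by move=> z w; rewrite creD creN.
- by move=> t [x y]; rewrite /creal; simpc.
- exact: cre_le_cabs.
Qed.

Lemma cim_CkR k : Ck small_C Om k (d : C -> C^o) ->
  CkR (plane_of Om) k (fun p => (coords (d (of_coords p))).2).
Proof.
move=> Cd; apply: (@CkR_of_Ck _ oOm cim) Cd.
- by move=> z w; rewrite cimD cimN.
- by move=> t [x y]; rewrite /creal; simpc.
- exact: cim_le_cabs.
Qed.

(** The triangles are spanned by the actual values [inner (A (e q)) (e q)], so the barycentric
    identity gives [d] exactly; closeness to the grid serves only to cover the range of [d]. *)
Lemma numerical_value_section (e : nat -> H) :
  (forall q, hnorm (e q) = 1) ->
  (forall i j, i != j -> inner (e i) (e j) = 0) ->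
  (forall i j, i != j -> inner (A (e i)) (e j) = 0) ->
  (forall q, ess_num_range A (grid_vertex q) ->
    cabs (inner (A (e q)) (e q) - grid_vertex q) < grid_mesh q) ->
  exists (K : C -> nat) (a : nat -> C -> RR),
    let u w := \sum_(q < K w) creal (a q w) *: e q in
    [/\ forall k, Ck small_C Om k (d : C -> C^o) -> Ck (@small_H H) Om k u,
        forall w, Om w -> hnorm (u w) = 1 &
        forall w, Om w -> inner (A (u w)) (u w) = d w].
Proof.
move=> e1 eo Ao eW.
pose lam q := inner (A (e q)) (e q).
have cover p : plane_of Om p ->
    exists j, Rlt 0 (bump (fun q => coords (lam q)) j (coords (d (of_coords p)))).
  by move=> Op; apply: (grid_cover _ lam _ eW); apply: dW.
have [K [a [Ca lf s1 sx sy]]] := smooth_barycentric_coordinates _ _ _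
  (open_plane_of oOm) cover (cre_CkR _ dc) (cim_CkR _ dc).
exists (fun w => K (coords w)), (fun q w => a q (coords w)); split.
- move=> k Cd; apply: (@Ck_combination Om oOm H e K e1 a k lf) => q.
  by apply: Ca; [exact: cre_CkR | exact: cim_CkR].
- move=> w /plane_of_coords Ow; apply/eqP.
  rewrite -(eqrXn2 (n := 2)) ?hnorm_ge0 //; apply/eqP; apply: creal_inj.
  rewrite hnorm_sqr (diagonal_form _ _ _ (bl_id H) _ (fun q => a q (coords w))) //.
  under eq_bigr do rewrite -hnorm_sqr e1 expr1n mulr1.
  have := s1 _ Ow; set n := K _ => E; rewrite expr1n -[X in _ = creal X]/(IZR 1) -E.
  by elim/big_rec2: _ => // i x y _ ->; rewrite crealD.
- move=> w /plane_of_coords Ow.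
  rewrite (diagonal_form _ _ _ bA _ (fun q => a q (coords w))) //.
  have dE : d w = Complex (coords (d (of_coords (coords w)))).1
                          (coords (d (of_coords (coords w)))).2.
    by rewrite coordsK; case: (d w).
  rewrite {}dE -(sx _ Ow) -(sy _ Ow); set n := K _.
  elim: n => [|n IH]; first by rewrite !big_ord0.
  by rewrite !big_ord_recr /= IH /lam; case: (inner _ _) => x y; rewrite /creal; simpc.
Qed.

End Construction.

Theorem theorem1p3 (H : hilbert) (A : H -> H) (Om : set C) (r : smoothness)
    (d : C -> C) :
  separable H -> infinite_dim H -> bounded_linear A -> copen Om ->
  CrC Om r d -> (forall w, Om w -> cinterior (ess_num_range A) (d w)) ->
  exists u : nat -> C -> H,
    (forall n, CrH Om r (u n)) /\
    (forall n w, Om w -> hnorm (u n w) = 1) /\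
    (forall m n, m <> n -> forall w w', Om w -> Om w' -> inner (u m w) (u n w') = 0) /\
    (forall n w, Om w -> inner (A (u n w)) (u n w) = d w) /\
    (exists (X : hilbert) (S : C -> X -> H),
       CrOp Om r S /\
       (forall w, Om w -> bounded_linear (S w)) /\
       (forall w, Om w -> is_isometry (S w)) /\
       (forall w, Om w -> forall x : X, adjoint (S w) (A (S w x)) = d w *: x)).
Proof.
move=> _ _ bA oOm Cd dW.
have dc : Ck small_C Om 0 (d : C -> C^o).
  move: Cd; rewrite /CrC /Cr; case: r => [[|k] h|h].
  - exact: h.
  - exact: (proj1 h).
  - exact: (h 0%N).
(* Since the same function works for every order [k], finite and infinite smoothness are handled
   alike. *)
have lift (V : lmodType C) small (f : C -> V) :
    (forall k, Ck small_C Om k (d : C -> C^o) -> Ck small Om k f) -> Cr small Om r f.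
  by move: Cd; rewrite /CrC /Cr; case: r => [k|] h g //; [apply: g | move=> k; apply: g].
suff [u [Cu nu ou du]] : exists u : nat -> C -> H, [/\
    forall n k, Ck small_C Om k (d : C -> C^o) -> Ck (@small_H H) Om k (u n),
    forall n w, Om w -> hnorm (u n w) = 1,
    forall m n, m <> n -> forall w w', Om w -> Om w' -> inner (u m w) (u n w') = 0 &
    forall n w, Om w -> inner (A (u n w)) (u n w) = d w].
  exists u; split; first by move=> n; apply: lift; apply: Cu.
  do 3!split=> //; exists complex_hilbert, (ray _ (u 0%N)); split.
    by apply: lift => k Ck_d; apply: Ck_ray; apply: Cu.
  split; first by move=> w _; apply: bl_ray.
  split=> w Ow x; first by rewrite hnormZ nu // mulr1 hnorm_complex.
  rewrite adjoint_ray /ray (blZ bA) innerZl du //.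
  exact: mulrC.
(* A point of [Om] supplies an element of the essential numerical range as default value; for empty
   [Om] everything is vacuous. *)
case: (pselect (exists w, Om w)) => [[w0 Ow0]|/forallNP Om0]; last first.
  exists (fun _ _ => 0); split=> [n k _|n w /Om0|m n _ w w' /Om0|n w /Om0] //.
  exact: Ck_vacuous.
have W0 : ess_num_range A (d w0).
  by have [eps [eps0 h]] := dW _ Ow0; apply: h; rewrite subrr cabs0.
(* The index codes a pair: the number [n] of the family and the vertex [q] within it. *)
pose idx k : nat * nat := odflt (0%N, 0%N) (unpickle k).
(* Vertices outside the essential numerical range are replaced by [d w0]. The covering uses only
   triangles with all vertices inside, and the barycentric identity tolerates any other triangle. *)
pose t k := if `[< ess_num_range A (grid_vertex (idx k).2) >]
  then grid_vertex (idx k).2 else d w0.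
have tW k : ess_num_range A (t k) by rewrite /t; case: ifPn => // /asboolP.
have [e [e1 eo Ao et]] := @essentially_diagonal_sequence H A t _ bA tW
  (fun k => mesh_gt0 (grid_triangle (idx k).2).1.1).
pose en (n q : nat) := e (pickle (n, q)).
have enq (n q m q' : nat) : (n, q) != (m, q') -> pickle (n, q) != pickle (m, q').
  by apply: contra => /eqP /(pcan_inj pickleK)->.
have sect n : exists (K : C -> nat) (a : nat -> C -> RR),
    let u w := \sum_(q < K w) creal (a q w) *: en n q in
    [/\ forall k, Ck small_C Om k (d : C -> C^o) -> Ck (@small_H H) Om k u,
        forall w, Om w -> hnorm (u w) = 1 &
        forall w, Om w -> inner (A (u w)) (u w) = d w].
  apply: (@numerical_value_section H A Om d bA oOm dW dc (en n)) => [q|i j ij|i j ij|q Wq].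
  - exact: e1.
  - by apply: eo; apply: enq; apply: contra ij => /eqP[->].
  - by apply: Ao; apply: enq; apply: contra ij => /eqP[->].
  - have := et (pickle (n, q)); rewrite /t /idx pickleK /=.
    by case: ifPn => // /asboolP.
have [K /choice[a S]] := choice sect.
exists (fun n w => \sum_(q < K n w) creal (a n q w) *: en n q); split.
- by move=> n k; case: (S n) => h _ _; exact: h.
- by move=> n; case: (S n).
(* Different families use disjoint sets of indices, so orthogonality holds for any two points. *)
- move=> m n mn w w' _ _; rewrite inner_suml big1 // => i _.
  rewrite inner_sumr big1 // => j _; rewrite innerZl innerZr eo ?mulr0 //.
  by apply: enq; apply/eqP => -[].
- by move=> n; case: (S n).
Qed.
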